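(* Let $p\colon M\to B$ and $q\colon N\to B$ be fibrations, let $f,g\colon M\to N$ be maps over $B$, and let $m_1\in M$. Let $S_M=p^{-1}(p(m_1))$ and $S_N=q^{-1}(p(m_1))$ be the fibers. Assume that all these spaces are pathwise connected CW-complexes and that $S_M$, $S_N$ and $B$ are $K(\pi,1)$ spaces. Let $\gamma\colon [0,1]\to S_N$ be a path from $f(m_1)$ to $g(m_1)$ and let $\gamma_\#\colon \pi_1(N,g(m_1))\to\pi_1(N,f(m_1))$ be the canonical change-of-basepoint isomorphism determined by $\gamma$. Then $f$ and $g$ are homotopic over $B$ if and only if $f_\#\sim_{S_N}\gamma_\#\circ g_\#$, where $f_\#\colon\pi_1(M,m_1)\to\pi_1(N,f(m_1))$ and $g_\#\colon\pi_1(M,m_1)\to\pi_1(N,g(m_1))$ are the induced homomorphisms.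
   Context: Fibration means Hurewicz fibration. A map $f\colon M\to N$ is over $B$ if $q\circ f=p$; two maps over $B$ are homotopic over $B$ if they are joined by a homotopy through maps over $B$. For homomorphisms $h_1,h_2\colon\pi_1(M,m_1)\to\pi_1(N,f(m_1))$ with $q_\#\circ h_i=p_\#$, $h_1\sim_{S_N}h_2$ means that there is $\omega\in\iota_\#(\pi_1(S_N,f(m_1)))$, where $\iota\colon S_N\to N$ is the inclusion, with $h_2(\upsilon)=\omega h_1(\upsilon)\omega^{-1}$ for all $\upsilon\in\pi_1(M,m_1)$. The isomorphism $\gamma_\#$ sends the class of a loop $\lambda$ at $g(m_1)$ to the class of the loop $\gamma\cdot\lambda\cdot\gamma^{-1}$ at $f(m_1)$. *)

(* Defs.v *)
From HB Require Import structures.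
From mathcomp Require Import all_boot all_order all_algebra generic_quotient.
From mathcomp Require Import lra.
From mathcomp Require Import all_classical.
From mathcomp Require Import reals topology normedtype continuous_path.

Set Implicit Arguments.
Unset Strict Implicit.
Unset Printing Implicit Defensive.

Import Order.TTheory GRing.Theory Num.Theory.
Import numFieldNormedType.Exports.

Local Open Scope classical_set_scope.
Local Open Scope ring_scope.
Local Open Scope quotient_scope.

Definition unit_interval (R : realType) : Type :=
  set_type [set x : R | 0 <= x <= 1].

HB.instance Definition _ (R : realType) :=
  Topological.copy (unit_interval R) (set_type [set x : R | 0 <= x <= 1]).

(* The retraction of the line onto the unit interval. *)
Section Clamp.
Context {R : realType}.
Local Notation I := (unit_interval R).

Lemma clamp_subproof (r : R) :
  Num.min 1 (Num.max 0 r) \in [set x : R | 0 <= x <= 1].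
Proof.
rewrite inE /=; apply/andP; split.
  by rewrite le_min ler01 le_max lexx.
by rewrite ge_min lexx.
Qed.

Definition clamp (r : R) : I := exist (fun x => x \in [set x : R | 0 <= x <= 1]) _ (clamp_subproof r).

Definition ival (t : I) : R := set_val t.

Lemma ival_ge0 t : 0 <= ival t. Proof. by have /andP[] := set_valP t. Qed.
Lemma ival_le1 t : ival t <= 1. Proof. by have /andP[] := set_valP t. Qed.

Lemma ival_inj : injective ival. Proof. exact: val_inj. Qed.

Lemma clampE r : 0 <= r -> r <= 1 -> ival (clamp r) = r.
Proof.
by move=> r0 r1; rewrite /ival/= set_valE /=; rewrite (max_idPr r0) (min_idPr r1).
Qed.

Lemma ivalK : cancel ival clamp.
Proof. by move=> t; apply: ival_inj; rewrite clampE ?ival_ge0 ?ival_le1. Qed.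

Lemma clamp0_neq1 : clamp 0 != clamp 1.
Proof.
apply/eqP => /(congr1 ival); rewrite !clampE // => /eqP.
by rewrite eq_sym oner_eq0.
Qed.

HB.instance Definition _ :=
  isBiPointed.Build (unit_interval R) clamp0_neq1.

Lemma izeroE : (zero : I) = clamp 0. Proof. by []. Qed.
Lemma ioneE : (one : I) = clamp 1. Proof. by []. Qed.
Lemma ival0 : ival zero = 0. Proof. by rewrite izeroE clampE. Qed.
Lemma ival1 : ival one = 1. Proof. by rewrite ioneE clampE. Qed.

Lemma ival_continuous : continuous ival.
Proof. exact: initial_continuous. Qed.

Lemma clamp_continuous : continuous clamp.
Proof.
apply: continuous_comp_initial => x.
apply: (@continuous_min R R (cst 1) ((cst 0 : R -> R^o) \max idfun)).
  exact: cvg_cst.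
by apply: continuous_max; [exact: cvg_cst|exact: cvg_id].
Qed.

End Clamp.

Section Homotopy.
Context {R : realType}.
Local Notation I := (unit_interval R).

Section ContinuityHelpers.
Context {S T U : topologicalType}.

Lemma cts_comp (f : S -> T) (g : T -> U) :
  continuous f -> continuous g -> continuous (fun x => g (f x)).
Proof. by move=> cf cg x; apply: continuous_comp; [exact: cf|exact: cg]. Qed.

Lemma cts_pair (f : S -> T) (g : S -> U) :
  continuous f -> continuous g -> continuous (fun x => (f x, g x)).
Proof. by move=> cf cg x; apply: cvg_pair; [exact: cf|exact: cg]. Qed.

Lemma cts_fst : continuous (fst : S * T -> S).
Proof. by move=> x; exact: cvg_fst. Qed.

Lemma cts_snd : continuous (snd : S * T -> T).
Proof. by move=> x; exact: cvg_snd. Qed.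

Lemma cts_paste (phi : S -> R) (u v : S -> T) :
  continuous phi -> continuous u -> continuous v ->
  (forall s, phi s = 2^-1 -> u s = v s) ->
  continuous (fun s => if phi s <= 2^-1 then u s else v s).
Proof.
move=> cphi cu cv uv.
have cA : closed [set s | phi s <= 2^-1].
  apply: (@preimage_closed _ _ phi [set r | r <= 2^-1]); last exact: closed_le.
  by move=> ? _; exact: cphi.
have cB : closed [set s | 2^-1 <= phi s].
  apply: (@preimage_closed _ _ phi [set r | 2^-1 <= r]); last exact: closed_ge.
  by move=> ? _; exact: cphi.
apply/continuous_subspace_setT.
have -> : [set: S] = [set s | phi s <= 2^-1] `|` [set s | 2^-1 <= phi s].
  by apply/seteqP; split => // s _ /=; apply/orP; exact: le_total.
apply: withinU_continuous => //.
- apply: (@subspace_eq_continuous _ _ _ u); last exact: continuous_subspaceT.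
  by move=> s; rewrite inE => /= hs; rewrite /from_subspace hs.
- apply: (@subspace_eq_continuous _ _ _ v); last exact: continuous_subspaceT.
  move=> s; rewrite inE => /= hs; rewrite /from_subspace; case: ifPn => // hs'.
  by apply/esym/uv/eqP; rewrite eq_le hs hs'.
Qed.

End ContinuityHelpers.

Lemma mulr2V : 2 * 2^-1 = 1 :> R.
Proof. by rewrite divff ?pnatr_eq0. Qed.

Lemma cts_ival {S : topologicalType} (f : S -> I) :
  continuous f -> continuous (fun s => ival (f s)).
Proof. by move=> cf; apply: cts_comp => //; exact: ival_continuous. Qed.

Lemma cts_clamp {S : topologicalType} (f : S -> R) :
  continuous f -> continuous (fun s => clamp (f s)).
Proof. by move=> cf; apply: cts_comp => //; exact: clamp_continuous. Qed.

Lemma cts_addr {S : topologicalType} (f g : S -> R) :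
  continuous f -> continuous g -> continuous (fun s => f s + g s).
Proof. by move=> cf cg s; apply: cvgD; [exact: cf|exact: cg]. Qed.

Lemma cts_oppr {S : topologicalType} (f : S -> R) :
  continuous f -> continuous (fun s => - f s).
Proof. by move=> cf s; apply: cvgN; exact: cf. Qed.

Lemma cts_mulr {S : topologicalType} (f g : S -> R) :
  continuous f -> continuous g -> continuous (fun s => f s * g s).
Proof. by move=> cf cg s; apply: cvgM; [exact: cf|exact: cg]. Qed.

Lemma cts_minr {S : topologicalType} (f g : S -> R) :
  continuous f -> continuous g -> continuous (fun s => Num.min (f s) (g s)).
Proof. by move=> cf cg s; apply: (@continuous_min R S f g); [exact: cf|exact: cg]. Qed.

Lemma cts_cst {S T : topologicalType} (y : T) : continuous (fun _ : S => y).
Proof. by move=> s; exact: cvg_cst. Qed.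

Lemma cts_id {S : topologicalType} : continuous (fun s : S => s).
Proof. by move=> s; exact: cvg_id. Qed.

Definition homotopic_rel {T X : topologicalType} (A : set T) (f g : T -> X) :=
  exists H : T * I -> X,
    [/\ continuous H,
        forall x, H (x, zero) = f x,
        forall x, H (x, one) = g x &
        forall x t, A x -> H (x, t) = f x].

Section HomotopicRel.
Context {T X : topologicalType} (A : set T).
Implicit Types f g h : T -> X.

Lemma homotopic_rel_refl f : continuous f -> homotopic_rel A f f.
Proof.
move=> cf; exists (fun xt => f xt.1); split=> //.
exact: cts_comp cts_fst cf.
Qed.

Lemma homotopic_rel_sym f g : homotopic_rel A f g -> homotopic_rel A g f.
Proof.
move=> [H [cH H0 H1 HA]].
exists (fun xt => H (xt.1, clamp (1 - ival xt.2))); split.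
- apply: cts_comp cH; apply: cts_pair; first exact: cts_fst.
  apply/cts_clamp/cts_addr; first exact: cts_cst.
  by apply/cts_oppr/cts_ival; exact: cts_snd.
- by move=> x /=; rewrite ival0 subr0 -ioneE.
- by move=> x /=; rewrite ival1 subrr -izeroE.
- by move=> x t Ax /=; rewrite HA // -H1 HA.
Qed.

Lemma homotopic_rel_trans f g h :
  homotopic_rel A f g -> homotopic_rel A g h -> homotopic_rel A f h.
Proof.
move=> [H [cH H0 H1 HA]] [K [cK K0 K1 KA]].
exists (fun xt => if ival xt.2 <= 2^-1 then H (xt.1, clamp (2 * ival xt.2))
                  else K (xt.1, clamp (2 * ival xt.2 - 1))); split.
- apply: cts_paste.
  + by apply: cts_ival; exact: cts_snd.
  + apply: cts_comp cH; apply: cts_pair; first exact: cts_fst.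
    apply/cts_clamp/cts_mulr; first exact: cts_cst.
    by apply: cts_ival; exact: cts_snd.
  + apply: cts_comp cK; apply: cts_pair; first exact: cts_fst.
    apply/cts_clamp/cts_addr; last exact: cts_cst.
    apply/cts_mulr; first exact: cts_cst.
    by apply: cts_ival; exact: cts_snd.
  + by move=> [x t] /= ->; rewrite mulr2V subrr -ioneE -izeroE H1 K0.
- by move=> x /=; rewrite ival0 invr_ge0 ler0n mulr0 -izeroE.
- move=> x /=; rewrite ival1 ifF; last by apply/negbTE; rewrite -ltNge; lra.
  by rewrite (_ : 2 * 1 - 1 = 1) -?ioneE //; lra.
- move=> x t Ax /=; case: ifP => _; first exact: HA.
  by rewrite KA // -H1 HA.
Qed.

End HomotopicRel.

End Homotopy.
Arguments homotopic_rel R {T X} A f g.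

Section Paths.
Context {R : realType} {X : topologicalType}.
Local Notation I := (unit_interval R).

Section Concatenation.
Context {x y z : X} (a : {path I from x to y in X}) (b : {path I from y to z in X}).

Definition cat_fun (t : I) : X :=
  if ival t <= 2^-1 then a (clamp (2 * ival t)) else b (clamp (2 * ival t - 1)).

Lemma cat_fun_continuous : continuous cat_fun.
Proof.
apply: cts_paste; first exact: ival_continuous.
- apply: cts_comp (@cts_fun _ _ a); apply/cts_clamp/cts_mulr; first exact: cts_cst.
  exact: ival_continuous.
- apply: cts_comp (@cts_fun _ _ b).
  apply/cts_clamp/cts_addr; last exact: cts_cst.
  by apply: cts_mulr; [exact: cts_cst | exact: ival_continuous].
- move=> s ->; rewrite mulr2V subrr -ioneE -izeroE.
  by rewrite path_one path_zero.
Qed.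

Lemma cat_fun0 : cat_fun zero = x.
Proof. by rewrite /cat_fun ival0 invr_ge0 ler0n mulr0 -izeroE path_zero. Qed.

Lemma cat_fun1 : cat_fun one = z.
Proof.
rewrite /cat_fun ival1 ifF; last by apply/negbTE; rewrite -ltNge; lra.
by rewrite (_ : 2 * 1 - 1 = 1) -?ioneE ?path_one //; lra.
Qed.

Definition path_cat : {path I from x to z in X} :=
  mk_path cat_fun_continuous cat_fun0 cat_fun1.

Lemma path_catE t : path_cat t =
  if ival t <= 2^-1 then a (clamp (2 * ival t)) else b (clamp (2 * ival t - 1)).
Proof. by []. Qed.

End Concatenation.

Section Inverse.
Context {x y : X} (a : {path I from x to y in X}).

Definition inv_fun (t : I) : X := a (clamp (1 - ival t)).

Lemma inv_fun_continuous : continuous inv_fun.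
Proof.
apply: cts_comp (@cts_fun _ _ a); apply/cts_clamp/cts_addr; first exact: cts_cst.
by apply: cts_oppr; exact: ival_continuous.
Qed.

Lemma inv_fun0 : inv_fun zero = y.
Proof. by rewrite /inv_fun ival0 subr0 -ioneE path_one. Qed.

Lemma inv_fun1 : inv_fun one = x.
Proof. by rewrite /inv_fun ival1 subrr -izeroE path_zero. Qed.

Definition path_inv : {path I from y to x in X} :=
  mk_path inv_fun_continuous inv_fun0 inv_fun1.

Lemma path_invE t : path_inv t = a (clamp (1 - ival t)).
Proof. by []. Qed.

End Inverse.

Definition path_cst (x : X) : {path I from x to x in X} := cst x.

Definition path_homotopic {x y : X} (a b : {path I from x to y in X}) : Prop :=
  homotopic_rel R [set zero; one] a b.

Lemma path_homotopicP {x y : X} (a b : {path I from x to y in X}) :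
  path_homotopic a b <->
  exists H : I * I -> X, [/\ continuous H, forall s, H (s, zero) = a s,
    forall s, H (s, one) = b s, forall t, H (zero, t) = x &
    forall t, H (one, t) = y].
Proof.
split=> [[H [cH H0 H1 HA]]|[H [cH H0 H1 Hx Hy]]]; exists H; split=> //.
- by move=> t; rewrite HA ?path_zero //; left.
- by move=> t; rewrite HA ?path_one //; right.
- by move=> _ t [->|->]; rewrite ?Hx ?Hy ?path_zero ?path_one.
Qed.

Lemma path_homotopic_refl {x y : X} (a : {path I from x to y in X}) :
  path_homotopic a a.
Proof. by apply: homotopic_rel_refl; exact: cts_fun. Qed.

Lemma path_homotopic_sym {x y : X} (a b : {path I from x to y in X}) :
  path_homotopic a b -> path_homotopic b a.
Proof. exact: homotopic_rel_sym. Qed.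

Lemma path_homotopic_trans {x y : X} (a b c : {path I from x to y in X}) :
  path_homotopic a b -> path_homotopic b c -> path_homotopic a c.
Proof. exact: homotopic_rel_trans. Qed.

Lemma path_cat_homotopic {x y z : X} (a a' : {path I from x to y in X})
    (b b' : {path I from y to z in X}) :
  path_homotopic a a' -> path_homotopic b b' ->
  path_homotopic (path_cat a b) (path_cat a' b').
Proof.
move=> /path_homotopicP[H [cH H0 H1 Hx Hy]] /path_homotopicP[K [cK K0 K1 Ky Kz]].
apply/path_homotopicP.
exists (fun st => if ival st.1 <= 2^-1 then H (clamp (2 * ival st.1), st.2)
                  else K (clamp (2 * ival st.1 - 1), st.2)); split.
- apply: cts_paste.
  + by apply: cts_ival; exact: cts_fst.
  + apply: cts_comp cH; apply: cts_pair; last exact: cts_snd.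
    apply/cts_clamp/cts_mulr; first exact: cts_cst.
    by apply: cts_ival; exact: cts_fst.
  + apply: cts_comp cK; apply: cts_pair; last exact: cts_snd.
    apply/cts_clamp/cts_addr; last exact: cts_cst.
    apply/cts_mulr; first exact: cts_cst.
    by apply: cts_ival; exact: cts_fst.
  + by move=> [s t] /= ->; rewrite mulr2V subrr -ioneE -izeroE Hy Ky.
- by move=> s /=; rewrite H0 K0.
- by move=> s /=; rewrite H1 K1.
- by move=> t /=; rewrite ival0 invr_ge0 ler0n mulr0 -izeroE.
- move=> t /=; rewrite ival1 ifF; last by apply/negbTE; rewrite -ltNge; lra.
  by rewrite (_ : 2 * 1 - 1 = 1) -?ioneE //; lra.
Qed.

Lemma path_inv_homotopic {x y : X} (a b : {path I from x to y in X}) :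
  path_homotopic a b -> path_homotopic (path_inv a) (path_inv b).
Proof.
move=> /path_homotopicP[H [cH H0 H1 Hx Hy]]; apply/path_homotopicP.
exists (fun st => H (clamp (1 - ival st.1), st.2)); split.
- apply: cts_comp cH; apply: cts_pair; last exact: cts_snd.
  apply/cts_clamp/cts_addr; first exact: cts_cst.
  by apply/cts_oppr/cts_ival; exact: cts_fst.
- by move=> s /=; rewrite H0.
- by move=> s /=; rewrite H1.
- by move=> t /=; rewrite ival0 subr0 -ioneE.
- by move=> t /=; rewrite ival1 subrr -izeroE.
Qed.

Lemma path_homotopic_reparam {x y x' y' : X} (c : {path I from x' to y' in X})
    (a b : {path I from x to y in X}) (phi psi : I -> R) :
  continuous phi -> continuous psi ->
  phi zero = psi zero -> phi one = psi one ->
  (forall t, a t = c (clamp (phi t))) -> (forall t, b t = c (clamp (psi t))) ->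
  path_homotopic a b.
Proof.
move=> cphi cpsi e0 e1 aE bE; apply/path_homotopicP.
exists (fun st => c (clamp ((1 - ival st.2) * phi st.1 + ival st.2 * psi st.1))).
split.
- apply: cts_comp (@cts_fun _ _ c); apply/cts_clamp/cts_addr; apply: cts_mulr.
  + apply: cts_addr; first exact: cts_cst.
    by apply/cts_oppr/cts_ival; exact: cts_snd.
  + by apply: cts_comp cphi; exact: cts_fst.
  + by apply: cts_ival; exact: cts_snd.
  + by apply: cts_comp cpsi; exact: cts_fst.
- by move=> s /=; rewrite ival0 subr0 mul1r mul0r addr0 -aE.
- by move=> s /=; rewrite ival1 subrr mul1r mul0r add0r -bE.
- by move=> t /=; rewrite e0 -mulrDl subrK mul1r -bE path_zero.
- by move=> t /=; rewrite e1 -mulrDl subrK mul1r -bE path_one.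
Qed.

End Paths.

Section FundamentalGroup.
Context {R : realType} {X : topologicalType} (x : X).
Local Notation I := (unit_interval R).
Local Notation loop := {path I from x to x in X}.

Definition loop_rel (a b : loop) : bool := `[< path_homotopic a b >].

Lemma loop_rel_refl : reflexive loop_rel.
Proof. by move=> a; apply/asboolP; exact: path_homotopic_refl. Qed.

Lemma loop_rel_sym : symmetric loop_rel.
Proof. by move=> a b; apply/asboolP/asboolP; exact: path_homotopic_sym. Qed.

Lemma loop_rel_trans : transitive loop_rel.
Proof.
move=> b a c /asboolP ab /asboolP bc; apply/asboolP.
exact: path_homotopic_trans ab bc.
Qed.

Canonical loop_equiv := EquivRel loop_rel loop_rel_refl loop_rel_sym loop_rel_trans.

Definition pi1 : Type := {eq_quot loop_equiv}.

HB.instance Definition _ := Choice.copy pi1 {eq_quot loop_equiv}.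

Definition loop_class (a : loop) : pi1 := \pi_({eq_quot loop_equiv}) a.
Definition loop_repr (u : pi1) : loop := repr (u : {eq_quot loop_equiv}).

Lemma loop_reprK : cancel loop_repr loop_class.
Proof. by move=> u; rewrite /loop_class /loop_repr reprK. Qed.

Lemma loop_classP (a b : loop) :
  loop_class a = loop_class b <-> path_homotopic a b.
Proof.
split=> [/eqquotP/asboolP //|ab]; apply/eqquotP; exact/asboolP.
Qed.

Lemma loop_repr_homotopic (a : loop) :
  path_homotopic (loop_repr (loop_class a)) a.
Proof. by apply/loop_classP; rewrite loop_reprK. Qed.

Definition pi1_one : pi1 := loop_class (path_cst x).
Definition pi1_mul (u v : pi1) : pi1 :=
  loop_class (path_cat (loop_repr u) (loop_repr v)).
Definition pi1_inv (u : pi1) : pi1 := loop_class (path_inv (loop_repr u)).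

Lemma pi1_mulE (a b : loop) :
  pi1_mul (loop_class a) (loop_class b) = loop_class (path_cat a b).
Proof.
by apply/loop_classP; apply: path_cat_homotopic; exact: loop_repr_homotopic.
Qed.

Lemma pi1_invE (a : loop) : pi1_inv (loop_class a) = loop_class (path_inv a).
Proof. by apply/loop_classP/path_inv_homotopic; exact: loop_repr_homotopic. Qed.

Lemma path_catA_homotopic (a b c : loop) :
  path_homotopic (path_cat a (path_cat b c)) (path_cat (path_cat a b) c).
Proof.
apply: path_homotopic_sym.
apply: (@path_homotopic_reparam _ _ _ _ _ _ (path_cat a (path_cat b c)) _ _
  (fun t => Num.min (2 * ival t) (Num.min (ival t + 4^-1) (2^-1 * ival t + 2^-1)))
  (fun t => ival t)).
- apply: cts_minr; last apply: cts_minr.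
  + by apply: cts_mulr; [exact: cts_cst|exact: ival_continuous].
  + by apply: cts_addr; [exact: ival_continuous|exact: cts_cst].
  + apply: cts_addr; last exact: cts_cst.
    by apply: cts_mulr; [exact: cts_cst|exact: ival_continuous].
- exact: ival_continuous.
- rewrite ival0 !mulr0 !add0r; apply/min_idPl.
  by rewrite le_min !invr_ge0 !ler0n.
- rewrite ival1 !mulr1; apply/eqP; rewrite eq_le; apply/andP; split.
    by rewrite !ge_min; apply/orP; right; apply/orP; right; lra.
  by rewrite !le_min; apply/and3P; split; lra.
- move=> t; have := ival_ge0 t; have := ival_le1 t.
  set s := ival t => s1 s0.
  have [h4|h4] := leP s 4^-1.
    have E : ival (clamp (2 * s)) = 2 * s by rewrite clampE //; lra.
    rewrite (min_idPl _); last by rewrite le_min; apply/andP; split; lra.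
    rewrite path_catE -/s ifT; last by lra.
    by rewrite !path_catE E ifT ?ifT //; lra.
  have [h2|h2] := leP s 2^-1.
    have E : ival (clamp (2 * s)) = 2 * s by rewrite clampE //; lra.
    have E' : ival (clamp (s + 4^-1)) = s + 4^-1 by rewrite clampE //; lra.
    rewrite (min_idPr _); last by rewrite ge_min; apply/orP; left; lra.
    rewrite (min_idPl _); last by lra.
    rewrite path_catE -/s ifT; last by lra.
    rewrite path_catE E ifF; last by apply/negbTE; rewrite -ltNge; lra.
    rewrite path_catE E' ifF; last by apply/negbTE; rewrite -ltNge; lra.
    have E2 : ival (clamp (2 * (s + 4^-1) - 1)) = 2 * (s + 4^-1) - 1.
      by rewrite clampE //; lra.
    rewrite path_catE E2 ifT; last by lra.
    by congr (b (clamp _)); lra.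
  have E : ival (clamp (2^-1 * s + 2^-1)) = 2^-1 * s + 2^-1.
    by rewrite clampE //; lra.
  rewrite (min_idPr _); last by rewrite ge_min; apply/orP; right; lra.
  rewrite (min_idPr _); last by lra.
  rewrite path_catE -/s ifF; last by apply/negbTE; rewrite -ltNge; lra.
  rewrite path_catE E ifF; last by apply/negbTE; rewrite -ltNge; lra.
  have E2 : ival (clamp (2 * (2^-1 * s + 2^-1) - 1)) = s.
    by rewrite clampE; lra.
  rewrite path_catE E2 ifF; last by apply/negbTE; rewrite -ltNge; lra.
  by congr (c (clamp _)); lra.
- by move=> t; rewrite ivalK.
Qed.

Lemma path_cat1p_homotopic (a : loop) :
  path_homotopic (path_cat (path_cst x) a) a.
Proof.
apply: (@path_homotopic_reparam _ _ _ _ _ _ a _ _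
  (fun t => - Num.min 0 (1 - 2 * ival t)) (fun t => ival t)).
- apply: cts_oppr; apply: cts_minr; first exact: cts_cst.
  apply: cts_addr; first exact: cts_cst.
  by apply/cts_oppr/cts_mulr; [exact: cts_cst|exact: ival_continuous].
- exact: ival_continuous.
- by rewrite ival0 (min_idPl _) ?oppr0 //; lra.
- by rewrite ival1 (min_idPr _); lra.
- move=> t; rewrite path_catE.
  case: leP => h; first by rewrite (min_idPl _) ?oppr0 -?izeroE ?path_zero //; lra.
  by rewrite (min_idPr _); [congr (a (clamp _))|]; lra.
- by move=> t; rewrite ivalK.
Qed.

Lemma path_catp1_homotopic (a : loop) :
  path_homotopic (path_cat a (path_cst x)) a.
Proof.
apply: (@path_homotopic_reparam _ _ _ _ _ _ a _ _
  (fun t => Num.min 1 (2 * ival t)) (fun t => ival t)).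
- apply: cts_minr; first exact: cts_cst.
  by apply: cts_mulr; [exact: cts_cst|exact: ival_continuous].
- exact: ival_continuous.
- by rewrite ival0 (min_idPr _); lra.
- by rewrite ival1 (min_idPl _) //; lra.
- move=> t; rewrite path_catE.
  case: leP => h; first by rewrite (min_idPr _) //; lra.
  by rewrite (min_idPl _) -?ioneE ?path_one //; lra.
- by move=> t; rewrite ivalK.
Qed.

Lemma path_catpV_homotopic (a : loop) :
  path_homotopic (path_cat a (path_inv a)) (path_cst x).
Proof.
apply: (@path_homotopic_reparam _ _ _ _ _ _ a _ _
  (fun t => Num.min (2 * ival t) (2 - 2 * ival t)) (fun=> 0)).
- apply: cts_minr; first by apply: cts_mulr; [exact: cts_cst|exact: ival_continuous].
  apply: cts_addr; first exact: cts_cst.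
  by apply/cts_oppr/cts_mulr; [exact: cts_cst|exact: ival_continuous].
- exact: cts_cst.
- by rewrite ival0 (min_idPl _); lra.
- by rewrite ival1 (min_idPr _); lra.
- move=> t; have := ival_le1 t => t1.
  rewrite path_catE.
  case: leP => h; first by rewrite (min_idPl _) //; lra.
  rewrite path_invE clampE; [|lra..].
  by rewrite (min_idPr _); [congr (a (clamp _))|]; lra.
- by move=> t; rewrite -izeroE path_zero.
Qed.

Lemma path_catVp_homotopic (a : loop) :
  path_homotopic (path_cat (path_inv a) a) (path_cst x).
Proof.
apply: (@path_homotopic_reparam _ _ _ _ _ _ a _ _
  (fun t => - Num.min (2 * ival t - 1) (1 - 2 * ival t)) (fun=> 1)).
- apply: cts_oppr; apply: cts_minr; apply: cts_addr; try exact: cts_cst.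
    by apply: cts_mulr; [exact: cts_cst|exact: ival_continuous].
  by apply/cts_oppr/cts_mulr; [exact: cts_cst|exact: ival_continuous].
- exact: cts_cst.
- by rewrite ival0 (min_idPl _); lra.
- by rewrite ival1 (min_idPr _); lra.
- move=> t; have := ival_ge0 t => t0.
  rewrite path_catE.
  case: leP => h; last by rewrite (min_idPr _); [congr (a (clamp _))|]; lra.
  rewrite path_invE clampE; [|lra..].
  by rewrite (min_idPl _); [congr (a (clamp _))|]; lra.
- by move=> t; rewrite -ioneE path_one.
Qed.

Lemma pi1_mulA : associative pi1_mul.
Proof.
move=> u v w; rewrite -[u]loop_reprK -[v]loop_reprK -[w]loop_reprK !pi1_mulE.
by apply/loop_classP; exact: path_catA_homotopic.
Qed.

Lemma pi1_mul1 : left_id pi1_one pi1_mul.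
Proof.
move=> u; rewrite -[u]loop_reprK pi1_mulE.
by apply/loop_classP; exact: path_cat1p_homotopic.
Qed.

Lemma pi1_mulr1 : right_id pi1_one pi1_mul.
Proof.
move=> u; rewrite -[u]loop_reprK pi1_mulE.
by apply/loop_classP; exact: path_catp1_homotopic.
Qed.

Lemma pi1_mulV : left_inverse pi1_one pi1_inv pi1_mul.
Proof.
move=> u; rewrite -[u]loop_reprK pi1_invE pi1_mulE.
by apply/loop_classP; exact: path_catVp_homotopic.
Qed.

Lemma pi1_mulrV : right_inverse pi1_one pi1_inv pi1_mul.
Proof.
move=> u; rewrite -[u]loop_reprK pi1_invE pi1_mulE.
by apply/loop_classP; exact: path_catpV_homotopic.
Qed.

HB.instance Definition _ := isGroup.Build pi1
  pi1_mulA pi1_mul1 pi1_mulr1 pi1_mulV pi1_mulrV.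

End FundamentalGroup.
Arguments pi1 R {X} x.
Arguments loop_class {R X x} a.

Section Functoriality.
Context {R : realType} {X Y : topologicalType}.
Local Notation I := (unit_interval R).

Definition pi1_map (f : continuousType X Y) {x : X} (u : pi1 R x) : pi1 R (f x) :=
  loop_class (f \o loop_repr u).

(* c_#, sending the class of a loop l at y to that of c . l . c^-1 at x *)
Definition pi1_change {x y : X} (c : {path I from x to y in X}) (u : pi1 R y) :
    pi1 R x :=
  loop_class (path_cat (path_cat c (loop_repr u)) (path_inv c)).

Lemma path_comp_homotopic (f : continuousType X Y) {x y : X}
    (a b : {path I from x to y in X}) :
  path_homotopic a b ->
  path_homotopic (f \o a : {path I from f x to f y in Y}) (f \o b).
Proof.
move=> /path_homotopicP[H [cH H0 H1 Hx Hy]]; apply/path_homotopicP.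
exists (fun st => f (H st)); split=> [|s|s|t|t]; rewrite /= ?H0 ?H1 ?Hx ?Hy //.
by apply: cts_comp cH _; exact: cts_fun.
Qed.

Lemma pi1_mapE (f : continuousType X Y) (x : X) (a : {path I from x to x in X}) :
  pi1_map f (loop_class a) = loop_class (f \o a).
Proof.
by apply/loop_classP/path_comp_homotopic; exact: loop_repr_homotopic.
Qed.

Lemma pi1_changeE {x y : X} (c : {path I from x to y in X})
    (a : {path I from y to y in X}) :
  pi1_change c (loop_class a) = loop_class (path_cat (path_cat c a) (path_inv c)).
Proof.
apply/loop_classP/path_cat_homotopic; last exact: path_homotopic_refl.
apply: path_cat_homotopic; first exact: path_homotopic_refl.
exact: loop_repr_homotopic.
Qed.

End Functoriality.

Definition path_connected (R : realType) (X : topologicalType) : Prop :=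
  $|X| /\ forall x y : X, $|{path (unit_interval R) from x to y in X}|.

Definition cube (R : realType) (n : nat) : Type :=
  set_type [set s : 'rV[R]_n | forall i, 0 <= s ord0 i <= 1].

HB.instance Definition _ (R : realType) (n : nat) :=
  Topological.copy (cube R n)
    (set_type [set s : 'rV[R]_n | forall i, 0 <= s ord0 i <= 1]).

Definition cube_val {R : realType} {n : nat} (s : cube R n) : 'rV[R]_n :=
  set_val s.

Definition cube_boundary {R : realType} {n : nat} : set (cube R n) :=
  [set s | exists i, cube_val s ord0 i = 0 \/ cube_val s ord0 i = 1].

Section HigherHomotopy.
Context {R : realType} {X : topologicalType} (n : nat) (x : X).

Definition spheroids : set (continuousType (cube R n) X) :=
  [set f | forall s, cube_boundary s -> f s = x].

Definition spheroid_rel (f g : spheroids) : bool :=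
  `[< homotopic_rel R cube_boundary (set_val f) (set_val g) >].

Lemma spheroid_rel_refl : reflexive spheroid_rel.
Proof. by move=> f; apply/asboolP/homotopic_rel_refl; exact: cts_fun. Qed.

Lemma spheroid_rel_sym : symmetric spheroid_rel.
Proof. by move=> f g; apply/asboolP/asboolP; exact: homotopic_rel_sym. Qed.

Lemma spheroid_rel_trans : transitive spheroid_rel.
Proof.
move=> g f h /asboolP fg /asboolP gh; apply/asboolP.
exact: homotopic_rel_trans fg gh.
Qed.

Canonical spheroid_equiv :=
  EquivRel spheroid_rel spheroid_rel_refl spheroid_rel_sym spheroid_rel_trans.

(* The underlying set of pi_n(X, x); it is only used for n >= 2, to say that
   it has a single element, so its group law is not defined. *)
Definition pi_set : Type := {eq_quot spheroid_equiv}.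

End HigherHomotopy.
Arguments pi_set R {X} n x.

Definition is_K_pi_1 (R : realType) (X : topologicalType) : Prop :=
  path_connected R X /\
  forall n : nat, (2 <= n)%N -> forall (x : X) (u v : pi_set R n x), u = v.

Definition disk (R : realType) (n : nat) : Type :=
  set_type [set s : 'rV[R]_n | \sum_i s ord0 i ^+ 2 <= 1].

HB.instance Definition _ (R : realType) (n : nat) :=
  Topological.copy (disk R n)
    (set_type [set s : 'rV[R]_n | \sum_i s ord0 i ^+ 2 <= 1]).

Definition disk_val {R : realType} {n : nat} (s : disk R n) : 'rV[R]_n :=
  set_val s.

Definition disk_interior {R : realType} {n : nat} : set (disk R n) :=
  [set s | \sum_i disk_val s ord0 i ^+ 2 < 1].

Definition disk_sphere {R : realType} {n : nat} : set (disk R n) :=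
  [set s | \sum_i disk_val s ord0 i ^+ 2 = 1].

(* J.H.C. Whitehead's definition, through characteristic maps: the open cells
   partition the space, each boundary sphere lies in finitely many cells, all of
   lower dimension, and the topology is the weak one. *)
Record cw_structure (R : realType) (X : topologicalType) := CWStructure {
  cell : Type;
  cell_dim : cell -> nat;
  char_map : forall e : cell, disk R (cell_dim e) -> X;
  char_map_continuous : forall e, continuous (@char_map e);
  char_map_inj : forall e s t, disk_interior s -> disk_interior t ->
    @char_map e s = @char_map e t -> s = t;
  (* the inverse of [char_map e] on the open cell is continuous *)
  char_map_embedding : forall e (U : set (disk R (cell_dim e))),
    open U -> U `<=` disk_interior ->
    exists2 V : set X, open V &
      @char_map e @` U = V `&` (@char_map e @` disk_interior);
  cells_partition : forall x : X,
    exists! e, (@char_map e @` disk_interior) x;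
  closure_finite : forall e, exists F : set cell,
    [/\ finite_set F,
        forall e', F e' -> (cell_dim e' < cell_dim e)%N &
        @char_map e @` disk_sphere `<=`
          \bigcup_(e' in F) (@char_map e' @` disk_interior)];
  weak_topology : forall A : set X,
    closed A <-> forall e, closed (@char_map e @^-1` A)
}.

Definition is_CW_complex (R : realType) (X : topologicalType) : Prop :=
  hausdorff_space X /\ $|cw_structure R X|.

Definition hurewicz_fibration (R : realType) {E B : topologicalType}
    (p : E -> B) : Prop :=
  continuous p /\
  forall (Y : topologicalType) (h : Y -> E) (G : Y * unit_interval R -> B),
    continuous h -> continuous G -> (forall y, G (y, zero) = p (h y)) ->
    exists H : Y * unit_interval R -> E,
      [/\ continuous H, forall y, H (y, zero) = h y &
          forall yt, p (H yt) = G yt].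

Definition homotopic_over (R : realType) {M N B : topologicalType}
    (p : M -> B) (q : N -> B) (f g : M -> N) : Prop :=
  exists H : M * unit_interval R -> N,
    [/\ continuous H,
        forall x, H (x, zero) = f x,
        forall x, H (x, one) = g x &
        forall x t, q (H (x, t)) = p x].

Definition fiber {E B : Type} (p : E -> B) (b : B) : Type :=
  set_type (p @^-1` [set b]).

HB.instance Definition _ (E : topologicalType) (B : Type) (p : E -> B) (b : B) :=
  Topological.copy (fiber p b) (set_type (p @^-1` [set b])).

Definition fiber_incl {E B : Type} {p : E -> B} {b : B} (y : fiber p b) : E :=
  set_val y.

Section FiberIncl.
Context {E : topologicalType} {B : Type} {p : E -> B} {b : B}.

Lemma fiber_incl_continuous : continuous (@fiber_incl E B p b).
Proof. exact: initial_continuous. Qed.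

HB.instance Definition _ :=
  isContinuous.Build (fiber p b) E (@fiber_incl E B p b) fiber_incl_continuous.

Definition fiber_path {R : realType} {y z : fiber p b}
    (c : {path (unit_interval R) from y to z in fiber p b}) :
    {path (unit_interval R) from fiber_incl y to fiber_incl z in E} :=
  fiber_incl \o c.

End FiberIncl.

Section FiberPoint.
Context {M N B : Type} {p : M -> B} {q : N -> B} {f : M -> N}.
Hypothesis fover : q \o f =1 p.

Lemma fiber_pt_subproof (m : M) : f m \in q @^-1` [set p m].
Proof. by rewrite inE; exact: fover. Qed.

Definition fiber_pt (m : M) : fiber q (p m) :=
  exist (fun y => y \in q @^-1` [set p m]) (f m) (fiber_pt_subproof m).

End FiberPoint.

(* h1 ~_S h2, where S is the fiber of q containing the basepoint y *)
Definition sim_fiber (R : realType) {M N B : topologicalType} {q : N -> B}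
    {b : B} {m : M} (y : fiber q b)
    (h1 h2 : pi1 R m -> pi1 R (fiber_incl y)) : Prop :=
  exists2 w : pi1 R (fiber_incl y),
    range (pi1_map (@fiber_incl N B q b) : pi1 R y -> pi1 R (fiber_incl y)) w &
    forall u : pi1 R m, h2 u = (w * h1 u * w^-1)%g.
Arguments sim_fiber R {M N B q b m} y h1 h2.

(* Main.v *)
Require Import Defs.
From HB Require Import structures.
From mathcomp Require Import all_boot all_order all_algebra generic_quotient.
From mathcomp Require Import lra ring.
From mathcomp Require Import all_classical.
From mathcomp Require Import reals topology normedtype realfun continuous_path.

Set Implicit Arguments.
Unset Strict Implicit.
Unset Printing Implicit Defensive.

Import Order.TTheory GRing.Theory Num.Theory.
Import numFieldNormedType.Exports.

Local Open Scope classical_set_scope.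
Local Open Scope ring_scope.
Local Open Scope quotient_scope.

(** Two maps f and g over B are compared on the base point first. A homotopy over B
from f to g moves f m1 to g m1 along a path delta in the fiber, and evaluating it
on loops shows f_# = delta_# g_#; then gamma followed by delta reversed is the loop
of the fiber by which f_# and gamma_# g_# differ (conj_of_square).

Conversely, correcting gamma by a loop of the fiber gives delta in the fiber with
f_# = delta_# g_# (square_of_conj), and a homotopy over B is built by induction
over the skeleta of M. Lifting over a cell times the interval, with prescribed
values on the boundary, meets one difficulty in each dimension (cell_lift). At a
vertex, delta is transported along a path in M. Because f_# = delta_# g_#, the
result does not depend on that path up to homotopy in N, so that over an edge the
two transported paths and the images of the edge under f and g bound a square in
N (admissible_square); since pi_2(B) = 0, the square can be moved over the edge
(lift_correction). Over a cell of dimension n >= 2, contracting the cell in B and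
using path connectedness of B reduces the lifting problem to the extension of a
map from an n-sphere into the given fiber, which is aspherical (fiber_lift).
Finally the pieces are glued: finiteness of the closure of cells gives continuity
of the data on the boundary of a cell, and the weak topology gives continuity of
the union (cellular_homotopy).

All deformations rest on one fact, tub_lift: in a cylinder over a ball, a lift given
on the bottom and on the sides extends to the whole cylinder. Homotopy extension is
the case of a one-point base. Its consequence rim_lift says that lifting and
extension problems may be replaced by homotopic ones, and square_conj, which
deforms a square with conjugated sides to one with the conjugating paths removed,
takes the place of computations with classes of paths. *)

(** * Continuity on closed sets *)

Section ClosedContinuity.
Context {S T : topologicalType}.

(** For closed A this is continuity of the restriction of f to A. Phrased with
closed sets, pasting along a union of closed sets is immediate, and f can remain
a total function. *)
Definition cts_on (A : set S) (f : S -> T) :=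
  forall C, closed C -> closed (A `&` f @^-1` C).

Lemma cts_on_setT (f : S -> T) : continuous f <-> cts_on setT f.
Proof.
split=> [/continuous_closedP cf C /cf|cf]; first by rewrite setTI.
by apply/continuous_closedP => C /cf; rewrite setTI.
Qed.

Lemma cts_on_continuous (A : set S) (f : S -> T) :
  closed A -> continuous f -> cts_on A f.
Proof.
by move=> cA /continuous_closedP cf C /cf; apply: closedI.
Qed.

Lemma cts_on_setU (A B : set S) (f : S -> T) :
  cts_on A f -> cts_on B f -> cts_on (A `|` B) f.
Proof. by move=> cA cB C cC; rewrite setIUl; apply: closedU; auto. Qed.

Lemma cts_on_eq (A : set S) (f g : S -> T) :
  (forall s, A s -> f s = g s) -> cts_on A f -> cts_on A g.
Proof.
move=> fg cf C /cf; congr closed; apply/seteqP; split=> s /= [As];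
  by rewrite fg.
Qed.

End ClosedContinuity.

Lemma cts_on_comp (S T U : topologicalType) (D : set S) (A : set T)
    (g : S -> T) (f : T -> U) :
  cts_on D g -> (forall s, D s -> A (g s)) -> cts_on A f ->
  cts_on D (fun s => f (g s)).
Proof.
move=> cg gA cf C /cf/cg; congr closed; apply/seteqP; split=> s /= [Ds].
  by case.
by move=> Cfg; split=> //; split=> //; exact: gA.
Qed.

Lemma continuous_comp_on (S T U : topologicalType) (A : set T)
    (g : S -> T) (f : T -> U) :
  continuous g -> (forall s, A (g s)) -> cts_on A f ->
  continuous (fun s => f (g s)).
Proof.
by move=> /cts_on_setT cg gA cf; apply/cts_on_setT; apply: cts_on_comp cg _ cf.
Qed.

(** * Balls, and relative lifting over a cylinder *)

Section Balls.
Context {R : realType}.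
Local Notation I := (unit_interval R).

Lemma cts_maxr {S : topologicalType} (f g : S -> R) :
  continuous f -> continuous g -> continuous (fun s => Num.max (f s) (g s)).
Proof. by move=> cf cg s; apply: (@continuous_max R S f g); [exact: cf|exact: cg]. Qed.

Lemma cts_invr {S : topologicalType} (f : S -> R) :
  continuous f -> (forall s, f s != 0) -> continuous (fun s => (f s)^-1).
Proof. by move=> cf f0 s; apply: cvgV; [exact: f0|exact: cf]. Qed.

(** An abstract unit ball: rad is the gauge and dil k is the dilation of ratio k
about the centre. A product of two balls is again a ball, for the maximum of the
gauges, so that a cell and the cylinder over a cell are treated alike. *)
Record ball_space (Z : topologicalType) := BallSpace {
  rad : Z -> R;
  dil : R -> Z -> Z;
  rad_continuous : continuous rad;
  dil_continuous : continuous (fun kz : (R * Z)%type => dil kz.1 kz.2);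
  rad_ge0 : forall z, 0 <= rad z;
  rad_le1 : forall z, rad z <= 1;
  rad_dil : forall k z, 0 <= k -> k * rad z <= 1 -> rad (dil k z) = k * rad z;
  dil1 : forall z, dil 1 z = z;
  dil0 : forall z z', dil 0 z = dil 0 z'
}.

Definition rim Z (b : ball_space Z) : set Z := [set z | rad b z = 1].

Lemma closed_level {S : topologicalType} (f : S -> R) (c : R) :
  continuous f -> closed [set s | f s = c].
Proof.
move=> /continuous_closedP cf; apply: (cf [set c]).
exact: (@accessible_closed_set1 R (hausdorff_accessible (@Rhausdorff R))).
Qed.

Lemma rim_closed Z (b : ball_space Z) : closed (rim b).
Proof. by apply: closed_level; exact: rad_continuous. Qed.

Lemma zeroP (t : I) : t = zero <-> ival t = 0.
Proof. by split=> [->|t0]; [rewrite ival0|apply: ival_inj; rewrite ival0]. Qed.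

Lemma oneP (t : I) : t = one <-> ival t = 1.
Proof. by split=> [->|t1]; [rewrite ival1|apply: ival_inj; rewrite ival1]. Qed.

Lemma one_neq_zero : (one : I) <> zero.
Proof. by move/zeroP; rewrite ival1 => /eqP; rewrite oner_eq0. Qed.

Lemma closed_slice {S : topologicalType} (f : S -> I) (c : I) :
  continuous f -> closed [set s | f s = c].
Proof.
move=> cf; have -> : [set s | f s = c] = [set s | ival (f s) = ival c].
  by apply/seteqP; split=> s /= => [->|/ival_inj ->].
by apply: closed_level; apply: cts_ival.
Qed.

Definition product_ball Y Z (a : ball_space Y) (b : ball_space Z) :
  ball_space (Y * Z)%type.
Proof.
apply: (@BallSpace _ (fun w => Num.max (rad a w.1) (rad b w.2))
  (fun k w => (dil a k w.1, dil b k w.2))).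
- apply: cts_maxr; first exact: cts_comp cts_fst (@rad_continuous _ a).
  exact: cts_comp cts_snd (@rad_continuous _ b).
- apply: cts_pair.
    apply: (cts_comp _ (@dil_continuous _ a)
      (f := fun kz : R * (Y * Z) => (kz.1, kz.2.1))).
    apply: cts_pair; [exact: cts_fst|].
    exact: cts_comp cts_snd cts_fst.
  apply: (cts_comp _ (@dil_continuous _ b)
      (f := fun kz : R * (Y * Z) => (kz.1, kz.2.2))).
  apply: cts_pair; [exact: cts_fst|].
  exact: cts_comp cts_snd cts_snd.
- by move=> z; rewrite le_max rad_ge0.
- by move=> z; rewrite ge_max !rad_le1.
- move=> k z k0; rewrite maxr_pMr// ge_max => /andP[h h'] /=.
  by rewrite !rad_dil.
- by case=> y z; rewrite !dil1.
- by move=> z z'; rewrite (dil0 a z.1 z'.1) (dil0 b z.2 z'.2).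
Defined.

Definition interval_ball : ball_space I.
Proof.
apply: (@BallSpace _ (fun t => `|2 * ival t - 1|)
  (fun k t => clamp (2^-1 + k * (ival t - 2^-1)))).
- apply: cts_comp (@norm_continuous R R^o); apply: cts_addr; last exact: cts_cst.
  by apply: cts_mulr; [exact: cts_cst|exact: ival_continuous].
- apply/cts_clamp/cts_addr; first exact: cts_cst.
  apply: cts_mulr; first exact: cts_fst.
  apply: cts_addr; last exact: cts_cst.
  by apply: cts_ival; exact: cts_snd.
- by move=> t; exact: normr_ge0.
- move=> t; have := ival_ge0 t; have := ival_le1 t => h h'.
  by rewrite ler_norml; apply/andP; split; lra.
- move=> k t k0; rewrite -{1}(ger0_norm k0) -normrM ler_norml => /andP[h h'].
  rewrite clampE; [|nra..]. 
  by rewrite -{2}(ger0_norm k0) -normrM; congr (`|_|); lra.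
- by move=> t; rewrite mul1r addrC subrK ivalK.
- by move=> t t'; rewrite !mul0r.
Defined.

Lemma rim_interval (t : I) : rim interval_ball t <-> t = zero \/ t = one.
Proof.
rewrite /rim /=; split=> [|[->|->]].
- case: (ler0P (2 * ival t - 1)) => _ h; [left; apply/zeroP|right; apply/oneP]; lra.
- by rewrite ival0 mulr0 sub0r normrN1.
- by rewrite ival1 mulr1 ger0_norm; lra.
Qed.

Lemma rim_prod Y Z (a : ball_space Y) (b : ball_space Z) w :
  rim (product_ball a b) w <-> rim a w.1 \/ rim b w.2.
Proof.
rewrite /rim /=; have := rad_le1 a w.1; have := rad_le1 b w.2.
by case: (leP (rad a w.1) (rad b w.2)) => h h1 h2; split=> [e|[e|e]]; [right|lra|lra|left|lra|lra].
Qed.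

Section Cylinder.
Context {Z : topologicalType} (b : ball_space Z).

(** The open box of the homotopy lifting property for the pair formed by a ball
and its rim. *)
Definition tub : set (Z * I) := [set w | w.2 = zero \/ rim b w.1].

Lemma tub_closed : closed tub.
Proof.
have -> : tub = [set w | w.2 = zero] `|` [set w | rad b w.1 = 1].
  by apply/seteqP; split.
apply: closedU; first by apply: closed_slice; exact: cts_snd.
by apply: closed_level; exact: cts_comp cts_fst (@rad_continuous _ b).
Qed.

(** Start at w and move away from the axis by the dilation of ratio 1 + v while
descending by v: this is the value of v at which the tub is reached. Replacing the
radius by 1/2 in the denominator when it is smaller removes the singularity at the
centre without changing the minimum: from such a radius the bottom is reached no
later than the sides. *)
Definition lag (w : Z * I) : R :=
  Num.min (ival w.2) ((1 - rad b w.1) / Num.max (rad b w.1) 2^-1).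

Lemma max_half_gt0 (r : R) : 0 < Num.max r 2^-1.
Proof. by rewrite lt_max; apply/orP; right; rewrite invr_gt0. Qed.

Lemma lag_continuous : continuous lag.
Proof.
have crad : continuous (fun w : Z * I => rad b w.1).
  exact: cts_comp cts_fst (@rad_continuous _ b).
apply: cts_minr; first exact: cts_ival cts_snd.
apply: cts_mulr.
  by apply: cts_addr; [exact: cts_cst|exact: cts_oppr].
apply: cts_invr; first by apply: cts_maxr; [exact: crad|exact: cts_cst].
by move=> w; rewrite gt_eqF// max_half_gt0.
Qed.

Lemma lag_ge0 w : 0 <= lag w.
Proof.
rewrite /lag le_min ival_ge0 divr_ge0 ?subr_ge0 ?rad_le1//.
exact/ltW/max_half_gt0.
Qed.

Lemma lag_le w : lag w <= ival w.2.
Proof. by rewrite /lag ge_min lexx. Qed.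

Lemma lag_tub w : tub w -> lag w = 0.
Proof.
move=> [w0|w1]; apply/eqP; rewrite eq_le lag_ge0 andbT.
  by rewrite (le_trans (lag_le w))// w0 ival0.
by rewrite /lag (w1 : rad b w.1 = 1) subrr mul0r ge_min lexx orbT.
Qed.

Lemma lag_reaches w : lag w = ival w.2 \/ (1 + lag w) * rad b w.1 = 1.
Proof.
have r1 := rad_le1 b w.1.
have [h|h] := leP (rad b w.1) 2^-1.
  left; rewrite /lag; apply/min_idPl; rewrite (max_idPr h).
  rewrite ler_pdivlMr ?invr_gt0//; have := ival_le1 w.2; lra.
rewrite /lag (max_idPl (ltW h)); case: leP => _; [by left|right].
have ? : rad b w.1 != 0 by apply: lt0r_neq0; lra.
by rewrite mulrDl divfK// mul1r; lra.
Qed.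

(** A motion that leaves the tub at time 0, arrives at w at time lag w and then
stays there. *)
Definition slide (wu : (Z * I) * I) : Z * I :=
  let v := Num.max 0 (lag wu.1 - ival wu.2) in
  (dil b (1 + v) wu.1.1, clamp (ival wu.1.2 - v)).

Lemma slide_continuous : continuous slide.
Proof.
have cv : continuous (fun wu : (Z * I) * I => Num.max 0 (lag wu.1 - ival wu.2)).
  apply: cts_maxr; first exact: cts_cst.
  apply: cts_addr; first exact: cts_comp cts_fst lag_continuous.
  exact/cts_oppr/cts_ival/cts_snd.
apply: cts_pair.
  apply: (cts_comp _ (@dil_continuous _ b)
    (f := fun wu : (Z * I) * I => (1 + Num.max 0 (lag wu.1 - ival wu.2), wu.1.1))).
  apply: cts_pair; last exact: cts_comp cts_fst cts_fst.
  by apply: cts_addr cv; exact: cts_cst.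
apply/cts_clamp/cts_addr; last exact: cts_oppr.
by apply/cts_ival; exact: cts_comp cts_fst cts_snd.
Qed.

Lemma slide_end w u : lag w <= ival u -> slide (w, u) = w.
Proof.
move=> wu; rewrite /slide /= (max_idPl _) ?subr_le0// addr0 dil1 subr0 ivalK.
by case: w {wu}.
Qed.

Lemma slide_tub w : tub (slide (w, zero)).
Proof.
rewrite /slide /tub /rim /= ival0 subr0 (max_idPr (lag_ge0 w)).
case: (lag_reaches w) => [->|h]; first by left; rewrite subrr.
by right; rewrite rad_dil ?h// addr_ge0// lag_ge0.
Qed.

Lemma slide_id w u : tub w -> slide (w, u) = w.
Proof. by move=> /lag_tub e; apply: slide_end; rewrite e ival_ge0. Qed.

Definition to_tub (w : Z * I) : Z * I := slide (w, zero).

Lemma to_tub_continuous : continuous to_tub.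
Proof.
apply: cts_comp slide_continuous.
by apply: cts_pair; [exact: cts_id|exact: cts_cst].
Qed.

(** Homotopy lifting along the slides, starting on the tub, produces for each w a
lift of the slide towards w. It is read at the arrival time lag w instead of
time 1: points of the tub have lag 0, so there the lift has not yet moved away
from F, which gives equality with F and not merely a homotopy. *)
Theorem tub_lift {N B : topologicalType} (q : N -> B) (G : Z * I -> B)
    (F : Z * I -> N) :
  hurewicz_fibration R q -> continuous G -> cts_on tub F ->
  (forall w, tub w -> q (F w) = G w) ->
  exists H : Z * I -> N, [/\ continuous H, forall w, q (H w) = G w &
    forall w, tub w -> H w = F w].
Proof.
move=> [_ hlp] cG cF qF.
have [||w|H [cH H0 qH]] := hlp _ (fun w => F (to_tub w)) (fun wu => G (slide wu)).
- exact: continuous_comp_on to_tub_continuous slide_tub cF.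
- exact: cts_comp slide_continuous cG.
- by rewrite qF//; exact: slide_tub.
have ilag w : ival (clamp (lag w)) = lag w.
  by rewrite clampE ?lag_ge0// (le_trans (lag_le w)) ?ival_le1.
exists (fun w => H (w, clamp (lag w))); split.
- apply: cts_comp cH; apply: cts_pair; first exact: cts_id.
  exact/cts_clamp/lag_continuous.
- by move=> w; rewrite qH slide_end// ilag.
- by move=> w tw; rewrite lag_tub// -izeroE H0 /to_tub slide_id.
Qed.

End Cylinder.

(** Lifting over a one-point space, here the row vectors of length 0, is plain
extension; homotopy extension is thus a case of homotopy lifting. *)
Lemma trivial_fibration (X : topologicalType) :
  hurewicz_fibration R (fun _ : X => 0 : 'rV[R]_0).
Proof.
split=> [|Y h G ch _ _]; first exact: cts_cst.
exists (fun yt => h yt.1); split=> //; first exact: cts_comp cts_fst ch.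
by move=> yt; rewrite [G yt]thinmx0.
Qed.

End Balls.
Arguments ball_space R Z : clear implicits.
Arguments dil : simpl never.
Arguments rad : simpl never.
(** * Extending lifts from the rim of a ball *)

Section Extension.
Context {R : realType}.
Local Notation I := (unit_interval R).

Section RelativeLifting.
Context {Z : topologicalType} (b : ball_space R Z).

Lemma sides_closed : closed [set w : Z * I | rim b w.1].
Proof.
by apply: closed_level; exact: cts_comp cts_fst (@rad_continuous _ _ b).
Qed.

Lemma cts_on_tub {N : topologicalType} (f : Z -> N) (k : Z * I -> N) :
  continuous f -> cts_on [set w | rim b w.1] k ->
  (forall z, rim b z -> k (z, zero) = f z) ->
  cts_on (tub b) (fun w => if w.2 == zero then f w.1 else k w).
Proof.
move=> cf ck fk; apply: cts_on_setU.
  apply: (@cts_on_eq _ _ _ (fun w => f w.1)) => [w /= ->|]; first by rewrite eqxx.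
  apply: cts_on_continuous; last exact: cts_comp cts_fst cf.
  by apply: closed_slice; exact: cts_snd.
by apply: cts_on_eq ck => -[z u] /= rz; case: eqP => // ->; rewrite fk.
Qed.

(** The datum on the tub is split into an initial map f and a homotopy k on the
rim, the form in which it arises. *)
Theorem rel_lift {N B : topologicalType} (q : N -> B) (G : Z * I -> B)
    (f : Z -> N) (k : Z * I -> N) :
  hurewicz_fibration R q -> continuous G -> continuous f ->
  cts_on [set w | rim b w.1] k ->
  (forall z, rim b z -> k (z, zero) = f z) ->
  (forall z, q (f z) = G (z, zero)) ->
  (forall w, rim b w.1 -> q (k w) = G w) ->
  exists H : Z * I -> N, [/\ continuous H, forall w, q (H w) = G w,
    forall z, H (z, zero) = f z & forall w, rim b w.1 -> H w = k w].
Proof.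
move=> qfib cG cf ck kf qf qk.
have [|H [cH qH HF]] := tub_lift qfib cG (cts_on_tub cf ck kf).
  by move=> [z u] [/= ->|/= rz]; rewrite ?eqxx ?qf//; case: eqP => [->|_]; rewrite ?qf ?qk.
exists H; split=> // [z|[z u] /= rz].
  by rewrite HF /= ?eqxx//; left.
by rewrite HF /=; [case: eqP => // ->; rewrite kf|right].
Qed.

(** Whether a lift given on the rim extends to the ball depends only on the
lifting problem up to homotopy: an extension at time 1 is carried back to time 0 by
relative lifting along the reversed homotopy. *)
Lemma rim_lift {N B : topologicalType} (q : N -> B) (P : Z * I -> B)
    (F : Z * I -> N) (L : Z -> N) :
  hurewicz_fibration R q -> continuous P -> cts_on [set w | rim b w.1] F ->
  (forall w, rim b w.1 -> q (F w) = P w) ->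
  continuous L -> (forall z, q (L z) = P (z, one)) ->
  (forall z, rim b z -> L z = F (z, one)) ->
  exists L0 : Z -> N, [/\ continuous L0, forall z, q (L0 z) = P (z, zero) &
    forall z, rim b z -> L0 z = F (z, zero)].
Proof.
move=> qfib cP cF qF cL qL LF.
(* Reversing time turns the extension at time 1 into the initial map of the lift. *)
pose rev (w : Z * I) : Z * I := (w.1, clamp (1 - ival w.2)).
have crev : continuous rev.
  apply: cts_pair; first exact: cts_fst.
  apply/cts_clamp/cts_addr; first exact: cts_cst.
  exact/cts_oppr/cts_ival/cts_snd.
have rev0 z : rev (z, zero) = (z, one) by rewrite /rev /= ival0 subr0 -ioneE.
have rev1 z : rev (z, one) = (z, zero) by rewrite /rev /= ival1 subrr -izeroE.
have [||z rz|z|w rw|H [cH qH H0 HF]] :=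
  @rel_lift _ _ q (fun w => P (rev w)) L (fun w => F (rev w)) qfib _ cL.
- exact: cts_comp crev cP.
- apply: cts_on_comp cF => //; exact: cts_on_continuous sides_closed crev.
- by rewrite rev0 LF.
- by rewrite rev0 qL.
- by rewrite qF.
exists (fun z => H (z, one)); split=> [|z|z rz].
- apply: cts_comp cH; apply: cts_pair; [exact: cts_id|exact: cts_cst].
- by rewrite qH rev1.
- by rewrite HF// rev1.
Qed.

(** The homotopy extension property of a ball and its rim, obtained by lifting over
a one-point base. *)
Lemma rim_extend {X : topologicalType} (F : Z * I -> X) (L : Z -> X) :
  cts_on [set w | rim b w.1] F -> continuous L ->
  (forall z, rim b z -> L z = F (z, one)) ->
  exists2 L0 : Z -> X, continuous L0 &
    forall z, rim b z -> L0 z = F (z, zero).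
Proof.
move=> cF cL LF.
have [|//|//|L0 [cL0 _ L0F]] :=
  @rim_lift X 'rV[R]_0 (fun=> 0) (fun=> 0) F L (@trivial_fibration R X) _ cF _ cL _ LF.
  exact: cts_cst.
by exists L0.
Qed.

(** When the ball has dimension n + 1, the vanishing of pi_n(X) in a form free of
base points. *)
Definition fills (X : topologicalType) :=
  forall F : Z -> X, cts_on (rim b) F ->
  exists2 L : Z -> X, continuous L & forall z, rim b z -> L z = F z.

End RelativeLifting.

Lemma fills_transfer {Y Z X : topologicalType} (a : ball_space R Y)
    (b : ball_space R Z) (phi : Y -> Z) (psi : Z -> Y) :
  continuous phi -> continuous psi -> cancel phi psi ->
  (forall y, rim a y -> rim b (phi y)) -> (forall z, rim b z -> rim a (psi z)) ->
  fills b X -> fills a X.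
Proof.
move=> cphi cpsi phiK rphi rpsi bX F cF.
have [|L cL LF] := bX (fun z => F (psi z)).
  apply: cts_on_comp cF => //.
  by apply: cts_on_continuous => //; exact: rim_closed.
exists (fun y => L (phi y)); first exact: cts_comp cL.
by move=> y ry; rewrite LF ?phiK//; exact: rphi.
Qed.

Section Cylinder.
Context {Z : topologicalType} (b : ball_space R Z).
Let cyl : ball_space R (Z * I)%type := product_ball b interval_ball.

Lemma rim_cylinder w : rim cyl w <-> tub b w \/ w.2 = one.
Proof.
rewrite rim_prod rim_interval /tub /=; tauto.
Qed.

Lemma tub_rim w : tub b w -> rim cyl w.
Proof. by move=> tw; apply/rim_cylinder; left. Qed.

(** The rim of a cylinder consists of the tub and of the top, which is a copy of
the base ball whose own rim lies in the tub: relative lifting over that copy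
completes a lift known on the tub. *)
Lemma rim_homotopy_lift {N B : topologicalType} (q : N -> B)
    (P : (Z * I) * I -> B) (F : Z * I -> N) (K : (Z * I) * I -> N) :
  hurewicz_fibration R q -> continuous P -> cts_on (rim cyl) F ->
  cts_on [set w | tub b w.1] K ->
  (forall w, tub b w -> K (w, zero) = F w) ->
  (forall w, tub b w.1 -> q (K w) = P w) ->
  (forall w, rim cyl w -> q (F w) = P (w, zero)) ->
  exists H : (Z * I) * I -> N, [/\ cts_on [set w | rim cyl w.1] H,
    forall w, tub b w.1 -> H w = K w,
    forall w, rim cyl w -> H (w, zero) = F w &
    forall w, rim cyl w.1 -> q (H w) = P w].
Proof.
move=> qfib cP cF cK KF qK qF.
pose top (w : Z * I) : (Z * I) * I := ((w.1, one), w.2).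
have ctop : continuous top.
  apply: cts_pair; last exact: cts_snd.
  by apply: cts_pair; [exact: cts_fst|exact: cts_cst].
have clid : continuous (fun z : Z => (z, one : I)).
  by apply: cts_pair; [exact: cts_id|exact: cts_cst].
have rlid z : rim cyl (z, one) by apply/rim_cylinder; right.
have [||||z|w rw|T [cT qT T0 TK]] :=
  @rel_lift _ b _ _ q (fun w => P (top w)) (fun z => F (z, one))
    (fun w => K (top w)) qfib.
- exact: cts_comp ctop cP.
- exact: continuous_comp_on clid rlid cF.
- apply: cts_on_comp cK; last by move=> w rw; right.
  exact: cts_on_continuous (@sides_closed _ b) ctop.
- by move=> z rz; rewrite KF//; right.
- by rewrite qF.
- by rewrite qK//; right.
pose H (w : (Z * I) * I) := if w.1.2 == one then T (w.1.1, w.2) else K w.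
have HT z u : H ((z, one), u) = T (z, u) by rewrite /H eqxx.
have HK w : tub b w.1 -> H w = K w.
  case: w => -[z t] u /= tw; rewrite /H /=; case: eqP => // e; subst t.
  by case: tw => [/one_neq_zero//|rz]; rewrite TK.
have rimE : [set w : (Z * I) * I | rim cyl w.1] =
    [set w | tub b w.1] `|` [set w | w.1.2 = one].
  by apply/seteqP; split=> w /= /rim_cylinder.
exists H; split=> [|//|w|w].
- rewrite rimE; apply: cts_on_setU.
    by apply: cts_on_eq cK => w tw; rewrite HK.
  apply: (@cts_on_eq _ _ _ (fun w => T (w.1.1, w.2))).
    by case=> -[z t] u /= ->; rewrite HT.
  apply: cts_on_continuous.
    by apply: closed_slice; exact: cts_comp cts_fst cts_snd.
  apply: cts_comp cT; apply: cts_pair; last exact: cts_snd.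
  exact: cts_comp cts_fst cts_fst.
- case/rim_cylinder => [tw|]; first by rewrite HK ?KF.
  by case: w => z t /= ->; rewrite HT T0.
- case/rim_cylinder => [tw|]; first by rewrite HK ?qK.
  by case: w => -[z t] u /= ->; rewrite HT qT.
Qed.

Lemma to_tub_dil_continuous :
  continuous (fun w : (Z * I) * I => to_tub b (dil cyl (1 - ival w.2) w.1)).
Proof.
apply: cts_comp (@to_tub_continuous _ _ b).
apply: (cts_comp _ (@dil_continuous _ _ cyl)
  (f := fun w : (Z * I) * I => (1 - ival w.2, w.1))).
apply: cts_pair; last exact: cts_fst.
by apply: cts_addr; [exact: cts_cst|exact/cts_oppr/cts_ival/cts_snd].
Qed.

Lemma to_tubP w : tub b (to_tub b w).
Proof. exact: slide_tub. Qed.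

Lemma to_tub_id w : tub b w -> to_tub b w = w.
Proof. exact: slide_id. Qed.

Lemma sides_tub_closed : closed [set w : (Z * I) * I | tub b w.1].
Proof.
have /continuous_closedP := @cts_fst (Z * I)%type I.
by move=> /(_ _ (@tub_closed _ _ b)).
Qed.

(** Dilating towards the centre and retracting to the tub contracts the tub
within the rim. Followed by homotopy extension over the top, this deforms F to a
map that is constant on the tub, hence is a spheroid on the top; the null-homotopy
of that spheroid is an extension of the deformed map. *)
Theorem fills_cylinder (X : topologicalType) :
  (forall (x : X) (s : Z -> X), continuous s -> (forall z, rim b z -> s z = x) ->
    exists h : Z * I -> X, [/\ continuous h, forall z, h (z, zero) = x,
      forall z, h (z, one) = s z & forall z t, rim b z -> h (z, t) = x]) ->
  fills cyl X.
Proof.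
move=> null F cF.
have cK : continuous (fun w : (Z * I) * I =>
    F (to_tub b (dil cyl (1 - ival w.2) w.1))).
  apply: continuous_comp_on to_tub_dil_continuous _ cF => w.
  exact/tub_rim/to_tubP.
have [||w tw|//|//|H [cH HK H0 _]] := @rim_homotopy_lift X 'rV[R]_0 (fun=> 0)
  (fun=> 0) F _ (@trivial_fibration R X) _ cF (cts_on_continuous _ cK).
- exact: cts_cst.
- exact: sides_tub_closed.
- by rewrite /= ival0 subr0 (@dil1 _ _ cyl) to_tub_id.
have [[z0]|noZ] := pselect (inhabited Z); last first.
  by exists F => //; case=> z; case: noZ.
(* The dilation of ratio 0 does not depend on the point, so z0 may be any point. *)
pose x := F (to_tub b (dil cyl 0 (z0, zero))).
have Hx w : tub b w -> H (w, one) = x.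
  by move=> tw; rewrite HK//= ival1 subrr (dil0 cyl _ (z0, zero)).
have [||h [ch h0 h1 hx]] := null x (fun z => H ((z, one), one)).
- have := cH; apply: continuous_comp_on => [|z /=].
    apply: cts_pair; last exact: cts_cst.
    by apply: cts_pair; [exact: cts_id|exact: cts_cst].
  by apply/rim_cylinder; right.
- by move=> z rz; rewrite Hx//; right.
have [|L cL LF] := rim_extend cH ch.
  case=> z t /rim_cylinder[tw|/= ->]; last by rewrite h1.
  by rewrite Hx//; case: tw => [/= ->|/= rz]; rewrite ?h0 ?hx.
by exists L => // w rw; rewrite LF// H0.
Qed.

(** The domain of P contracts to its centre and B is path connected, so P
deforms to the constant map at b0. The lifting problem deforms along with P into
an extension problem in the fiber over b0. Hence asphericity of a single fiber
suffices for lifting over cells anywhere in B. *)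
Theorem fiber_lift {N B : topologicalType} (q : N -> B) (b0 : B)
    (P : Z * I -> B) (F : Z * I -> N) :
  hurewicz_fibration R q -> path_connected R B -> $|fiber q b0| ->
  fills cyl (fiber q b0) ->
  continuous P -> cts_on (rim cyl) F -> (forall w, rim cyl w -> q (F w) = P w) ->
  exists L : Z * I -> N, [/\ continuous L, forall w, q (L w) = P w &
    forall w, rim cyl w -> L w = F w].
Proof.
move=> qfib [_ Bpc] [y0] fillS cP cF qF.
have [[z0]|noZ] := pselect (inhabited Z); last first.
  by exists F; split=> //; case=> z; case: noZ.
have [c] := Bpc (P (dil cyl 0 (z0, zero))) b0.
(* First contract to the centre, then follow c to b0. *)
pose D (w : (Z * I) * I) := if ival w.2 <= 2^-1
  then P (dil cyl (1 - 2 * ival w.2) w.1) else c (clamp (2 * ival w.2 - 1)).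
have cD : continuous D.
  have c2 : continuous (fun w : (Z * I) * I => 2 * ival w.2).
    by apply: cts_mulr; [exact: cts_cst|exact/cts_ival/cts_snd].
  apply: cts_paste.
  - exact/cts_ival/cts_snd.
  - apply: cts_comp cP; apply: (cts_comp _ (@dil_continuous _ _ cyl)
      (f := fun w : (Z * I) * I => (1 - 2 * ival w.2, w.1))).
    apply: cts_pair; last exact: cts_fst.
    by apply: cts_addr; [exact: cts_cst|exact: cts_oppr].
  - apply: cts_comp (@cts_fun _ _ c).
    by apply/cts_clamp/cts_addr => //; exact: cts_cst.
  - by move=> w ->; rewrite mulr2V subrr -izeroE path_zero (dil0 cyl _ (z0, zero)).
have D0 w : D (w, zero) = P w.
  by rewrite /D /= ival0 invr_ge0 ler0n mulr0 subr0 (dil1 cyl).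
have D1 w : D (w, one) = b0.
  rewrite /D /= ival1 ifF; last by apply/negbTE; rewrite -ltNge; lra.
  by rewrite (_ : 2 * 1 - 1 = 1) -?ioneE ?path_one //; lra.
have [_ hlp] := qfib.
have cretr : continuous (fun wu : (Z * I) * I => (to_tub b wu.1, wu.2)).
  apply: cts_pair; last exact: cts_snd.
  exact: cts_comp cts_fst (@to_tub_continuous _ _ b).
have [||w|K [cK K0 qK]] := hlp _ (fun w => F (to_tub b w))
  (fun wu => D (to_tub b wu.1, wu.2)).
- apply: continuous_comp_on (@to_tub_continuous _ _ b) _ cF => w.
  exact/tub_rim/to_tubP.
- exact: cts_comp cretr cD.
- by rewrite /= D0 qF//; exact/tub_rim/to_tubP.
have [|wu tw|w rw|H [cH HK H0 qH]] := rim_homotopy_lift qfib cD cF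
    (cts_on_continuous sides_tub_closed cK).
- by move=> w tw; rewrite K0 to_tub_id.
- by rewrite qK to_tub_id//; case: wu tw.
- by rewrite D0 qF.
have rimf w : rim cyl w -> H (w, one) \in q @^-1` [set b0].
  by move=> rw; rewrite inE /= qH// D1.
(* At time 1 the lift over the rim takes values in the fiber; y0 is junk off the rim. *)
pose S w : fiber q b0 := if pselect (rim cyl w) is left rw
  then exist (fun y => y \in q @^-1` [set b0]) _ (rimf w rw) else y0.
have SE w : rim cyl w -> fiber_incl (S w) = H (w, one).
  by rewrite /S; case: pselect.
have cH1 : cts_on (rim cyl) (fun w => H (w, one)).
  apply: cts_on_comp cH => //; apply: cts_on_continuous; first exact: rim_closed.
  by apply: cts_pair; [exact: cts_id|exact: cts_cst].
have [|L cL LS] := fillS S.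
  move=> C /closed_openC[O oO OC]; have := cH1 _ (open_closedC oO).
  congr closed; apply/seteqP; split=> w /= [rw]; rewrite -SE// => h; split=> //.
    by apply: contrapT => nC; apply: h; rewrite -[O _]/((set_val @^-1` O) _) OC.
  by move=> Ow; have : (set_val @^-1` O) (S w) by []; rewrite OC.
have [|w|w rw|L0 [cL0 qL0 L0H]] :=
  rim_lift (b := cyl) qfib cD cH qH (L := fun w => fiber_incl (L w)).
- by apply: cts_comp cL _; exact: fiber_incl_continuous.
- by rewrite D1; have := set_valP (L w).
- by rewrite LS ?SE.
exists L0; split=> // w; first by rewrite qL0 D0.
by move=> rw; rewrite L0H// H0.
Qed.

End Cylinder.

(** The map K has the required values on the rim but covers q K instead of P.
These two maps to B agree on the rim, so that they are homotopic relative to the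
rim when B has no homotopy in the relevant dimension; lifting this homotopy moves K
to a lift of P. *)
Theorem lift_correction {Z N B : topologicalType} (b : ball_space R Z)
    (q : N -> B) (K : Z -> N) (P : Z -> B) :
  hurewicz_fibration R q -> fills (product_ball b interval_ball) B ->
  continuous K -> continuous P -> (forall z, rim b z -> q (K z) = P z) ->
  exists L : Z -> N, [/\ continuous L, forall z, q (L z) = P z &
    forall z, rim b z -> L z = K z].
Proof.
move=> qfib fillB cK cP qK.
have cqK : continuous (fun z => q (K z)) by apply: cts_comp cK _; case: qfib.
(* On the rim of the cylinder: P on the tub, q K on the top. *)
pose E (w : Z * I) := if w.2 == one then q (K w.1) else P w.1.
have [|G cG GE] := fillB E.
  have -> : rim (product_ball b interval_ball) = [set w | tub b w] `|` [set w | w.2 = one].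
    by apply/seteqP; split=> w /= /rim_cylinder.
  apply: cts_on_setU.
    apply: (@cts_on_eq _ _ _ (fun w => P w.1)).
      case=> z t tw; rewrite /E /=; case: eqP => // e; subst t.
      by case: tw => [/one_neq_zero//|/= rz]; rewrite qK.
    apply: cts_on_continuous; first exact: tub_closed.
    exact: cts_comp cts_fst cP.
  apply: (@cts_on_eq _ _ _ (fun w => q (K w.1))).
    by case=> z t /= ->; rewrite /E eqxx.
  apply: cts_on_continuous; last exact: cts_comp cts_fst cqK.
  by apply: closed_slice; exact: cts_snd.
have G1 z : G (z, one) = q (K z).
  by rewrite GE /E /= ?eqxx//; apply/rim_cylinder; right.
have G0 w : tub b w -> G w = P w.1.
  move=> tw; rewrite GE; last exact: tub_rim.
  case: w tw => z t tw; rewrite /E /=; case: eqP => // e; subst t.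
  by case: tw => [/one_neq_zero//|/= rz]; rewrite qK.
have [|w rw|//|//|//|L [cL qL LK]] := @rim_lift _ b _ _ q G (fun w => K w.1) K qfib cG.
- apply: cts_on_continuous; first exact: sides_closed.
  exact: cts_comp cts_fst cK.
- by rewrite /= G0 ?qK//; right.
by exists L; split=> // z; rewrite qL G0//; left.
Qed.

End Extension.
(** * Squares of paths *)

Section Squares.
Context {R : realType} {X : topologicalType}.
Local Notation I := (unit_interval R).

(** A filling of the loop in X with left, bottom, top and right sides as given.
Homotopies between composites of paths are expressed by squares with composite
sides. *)
Definition square (l bot top r : I -> X) := exists K : I * I -> X,
  [/\ continuous K, forall t, K (zero, t) = l t, forall t, K (one, t) = r t,
      forall s, K (s, zero) = bot s & forall s, K (s, one) = top s].

Lemma square_eq (l l' bot bot' top top' r r' : I -> X) :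
  l =1 l' -> bot =1 bot' -> top =1 top' -> r =1 r' ->
  square l bot top r -> square l' bot' top' r'.
Proof.
move=> el eb et er [K [cK Kl Kr Kb Kt]].
by exists K; split=> // x; rewrite -?el -?eb -?et -?er.
Qed.

Lemma path_homotopic_square {x y : X} (a b : {path I from x to y in X}) :
  path_homotopic a b <-> square (fun=> x) a b (fun=> y).
Proof.
by split=> [/path_homotopicP|] [H [cH ? ? ? ?]];
  [exists H|apply/path_homotopicP; exists H].
Qed.

(** The second coordinate is the time of a deformation of the four sides. *)
Lemma square_deform (l r bot top : I * I -> X) :
  continuous l -> continuous r -> continuous bot -> continuous top ->
  (forall s, l (zero, s) = bot (zero, s)) -> (forall s, l (one, s) = top (zero, s)) ->
  (forall s, r (zero, s) = bot (one, s)) -> (forall s, r (one, s) = top (one, s)) ->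
  square (fun t => l (t, one)) (fun t => bot (t, one))
         (fun t => top (t, one)) (fun t => r (t, one)) ->
  square (fun t => l (t, zero)) (fun t => bot (t, zero))
         (fun t => top (t, zero)) (fun t => r (t, zero)).
Proof.
move=> cl cr cb ct lb lt rb rt [K [cK Kl Kr Kb Kt]].
pose b : ball_space R (I * I)%type := product_ball interval_ball interval_ball.
have c1 : continuous (fun w : (I * I) * I => (w.1.1, w.2)).
  apply: cts_pair; last exact: cts_snd; exact: cts_comp cts_fst cts_fst.
have c2 : continuous (fun w : (I * I) * I => (w.1.2, w.2)).
  apply: cts_pair; last exact: cts_snd; exact: cts_comp cts_fst cts_snd.
pose F (w : (I * I) * I) :=
  if w.1.1 == zero then l (w.1.2, w.2) else if w.1.1 == one then r (w.1.2, w.2)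
  else if w.1.2 == zero then bot (w.1.1, w.2) else top (w.1.1, w.2).
have ozF : (one == zero :> I) = false by apply/eqP; exact: one_neq_zero.
have Fl t s : F ((zero, t), s) = l (t, s) by rewrite /F /= eqxx.
have Fr t s : F ((one, t), s) = r (t, s) by rewrite /F /= ozF eqxx.
have Fb u s : F ((u, zero), s) = bot (u, s).
  by rewrite /F /= eqxx; case: eqP => [->//|_]; case: eqP => [->//|].
have Ft u s : F ((u, one), s) = top (u, s).
  by rewrite /F /= ozF; case: eqP => [->//|_]; case: eqP => [->//|].
have rimE (w : I * I) : rim b w <-> (w.1 = zero \/ w.1 = one) \/ (w.2 = zero \/ w.2 = one).
  by rewrite rim_prod !rim_interval.
have [|w|L cL LF] := @rim_extend R _ b _ F K _ cK.
- have -> : [set w : (I * I) * I | rim b w.1] =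
      ([set w | w.1.1 = zero] `|` [set w | w.1.1 = one]) `|`
      ([set w | w.1.2 = zero] `|` [set w | w.1.2 = one]).
    by apply/seteqP; split=> w /= /rimE.
  apply: cts_on_setU; apply: cts_on_setU.
  + apply: (@cts_on_eq _ _ _ (fun w => l (w.1.2, w.2))).
      by case=> -[u t] s /= ->; rewrite Fl.
    apply: cts_on_continuous; last exact: cts_comp cl.
    by apply: closed_slice; exact: cts_comp cts_fst cts_fst.
  + apply: (@cts_on_eq _ _ _ (fun w => r (w.1.2, w.2))).
      by case=> -[u t] s /= ->; rewrite Fr.
    apply: cts_on_continuous; last exact: cts_comp cr.
    by apply: closed_slice; exact: cts_comp cts_fst cts_fst.
  + apply: (@cts_on_eq _ _ _ (fun w => bot (w.1.1, w.2))).
      by case=> -[u t] s /= ->; rewrite Fb.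
    apply: cts_on_continuous; last exact: cts_comp cb.
    by apply: closed_slice; exact: cts_comp cts_fst cts_snd.
  + apply: (@cts_on_eq _ _ _ (fun w => top (w.1.1, w.2))).
      by case=> -[u t] s /= ->; rewrite Ft.
    apply: cts_on_continuous; last exact: cts_comp ct.
    by apply: closed_slice; exact: cts_comp cts_fst cts_snd.
- by case: w => u t /rimE /= [[]|[]] ->;
    rewrite ?Kl ?Kr ?Kb ?Kt ?Fl ?Fr ?Fb ?Ft.
exists L; split=> // t; rewrite LF ?Fl ?Fr ?Fb ?Ft//; apply/rimE => /=; tauto.
Qed.

Definition flipI (s : I) : I := clamp (1 - ival s).

Lemma flipI_continuous : continuous flipI.
Proof.
apply/cts_clamp/cts_addr; first exact: cts_cst.
by apply/cts_oppr; exact: ival_continuous.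
Qed.

Lemma flipI0 : flipI zero = one.
Proof. by rewrite /flipI ival0 subr0 -ioneE. Qed.

Lemma flipI1 : flipI one = zero.
Proof. by rewrite /flipI ival1 subrr -izeroE. Qed.

Lemma square_deform_iff (l r bot top : I * I -> X) :
  continuous l -> continuous r -> continuous bot -> continuous top ->
  (forall s, l (zero, s) = bot (zero, s)) -> (forall s, l (one, s) = top (zero, s)) ->
  (forall s, r (zero, s) = bot (one, s)) -> (forall s, r (one, s) = top (one, s)) ->
  square (fun t => l (t, one)) (fun t => bot (t, one))
         (fun t => top (t, one)) (fun t => r (t, one)) <->
  square (fun t => l (t, zero)) (fun t => bot (t, zero))
         (fun t => top (t, zero)) (fun t => r (t, zero)).
Proof.
move=> cl cr cb ct lb lt rb rt; split; first exact: square_deform.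
have cf : continuous (fun w : I * I => (w.1, flipI w.2)).
  by apply: cts_pair; [exact: cts_fst|exact: cts_comp cts_snd flipI_continuous].
move=> sq; have := @square_deform (fun w => l (w.1, flipI w.2))
  (fun w => r (w.1, flipI w.2)) (fun w => bot (w.1, flipI w.2))
  (fun w => top (w.1, flipI w.2)).
rewrite /= flipI0 flipI1; apply=> //; exact: cts_comp cf _.
Qed.

Section Conjugation.
Context {x y x' y' : X} (a : {path I from x to y in X})
  (b : {path I from x' to x in X}) (c : {path I from y' to y in X}).

(** A deformation, in the second coordinate s, from a at s = 0 to the composite
of b, a and c reversed at s = 1, running through the last part of b, then a, then
back through the last part of c. The breakpoints s/4 and 1 - s/2 are chosen so
that both ends are these paths on the nose, in the parametrization of iterated
concatenation; no reparametrization is ever required. The terms 1/2 in the tests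
only bring them to the shape expected by the pasting lemma. *)
Definition conj_path (w : I * I) : X :=
  let u := ival w.1 in let s := ival w.2 in
  if u - 4^-1 * s + 2^-1 <= 2^-1 then b (clamp (1 - s + 4 * u))
  else if u + 2^-1 * s - 2^-1 <= 2^-1
       then a (clamp ((u - 4^-1 * s) / (1 - 3 / 4 * s)))
       else c (clamp (1 - s + 2 * (1 - u))).

Lemma conj_path_continuous : continuous conj_path.
Proof.
have cu : continuous (fun w : I * I => ival w.1) by exact: cts_ival cts_fst.
have cs : continuous (fun w : I * I => ival w.2) by exact: cts_ival cts_snd.
have cM (k : R) (h : I * I -> R) : continuous h -> continuous (fun w => k * h w).
  by move=> ch; apply: cts_mulr => //; exact: cts_cst.
have cA (k : R) (h : I * I -> R) : continuous h -> continuous (fun w => k + h w).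
  by move=> ch; apply: cts_addr => //; exact: cts_cst.
have cA' (k : R) (h : I * I -> R) : continuous h -> continuous (fun w => h w + k).
  by move=> ch; apply: cts_addr => //; exact: cts_cst.
have cB (h k : I * I -> R) : continuous h -> continuous k ->
    continuous (fun w => h w - k w).
  by move=> ch ck; apply: cts_addr => //; exact: cts_oppr.
have c1s : continuous (fun w : I * I => 1 - ival w.2).
  by apply: cA; exact: cts_oppr.
have d0 (w : I * I) : 0 < 1 - 3 / 4 * ival w.2.
  have := ival_le1 w.2; lra.
apply: cts_paste.
- by apply: (cA'); apply: cB => //; exact: cM.
- apply: cts_comp (@cts_fun _ _ b); apply/cts_clamp/cts_addr => //; exact: cM.
- apply: cts_paste.
  + by apply: (cA'); apply: cts_addr => //; exact: cM.
  + apply: cts_comp (@cts_fun _ _ a); apply/cts_clamp/cts_mulr.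
      by apply: cB => //; exact: cM.
    apply: cts_invr; last by move=> w; rewrite gt_eqF.
    by apply: cA; apply: cts_oppr; exact: cM.
  + apply: cts_comp (@cts_fun _ _ c); apply/cts_clamp/cts_addr => //.
    by apply: cM; apply: cA; exact: cts_oppr.
  + move=> w /= e; rewrite (_ : 1 - ival w.2 + _ = 1); last by lra.
    rewrite (_ : ival w.1 - _ = 1 - 3 / 4 * ival w.2); last by lra.
    by rewrite divff ?gt_eqF// -ioneE !path_one.
- move=> w /= e; have := ival_le1 w.2; have := ival_ge0 w.2 => s0 s1.
  rewrite ifT; last by lra.
  rewrite (_ : ival w.1 - _ = 0); last by lra.
  rewrite mul0r -izeroE path_zero (_ : 1 - _ + _ = 1); last by lra.
  by rewrite -ioneE path_one.
Qed.

Lemma conj_path_start s : conj_path (zero, s) = b (flipI s).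
Proof.
have s0 := ival_ge0 s.
rewrite /conj_path /= ival0 ifT; last by lra.
by rewrite mulr0 addr0.
Qed.

Lemma conj_path_stop s : conj_path (one, s) = c (flipI s).
Proof.
have s0 := ival_ge0 s; have s1 := ival_le1 s.
rewrite /conj_path /= ival1 ifF; last by apply/negbTE; rewrite -ltNge; lra.
case: ifP => [h|_]; last by rewrite subrr mulr0 addr0.
have -> : s = zero by apply/zeroP; lra.
by rewrite flipI0 ival0 !mulr0 !subr0 divr1 -ioneE !path_one.
Qed.

Lemma conj_path0 u : conj_path (u, zero) = a u.
Proof.
have u0 := ival_ge0 u; have u1 := ival_le1 u.
rewrite /conj_path /= ival0 !mulr0 !subr0 divr1 ivalK.
case: ifP => [h|_].
  have -> : u = zero by apply/zeroP; lra.
  by rewrite ival0 mulr0 addr0 -ioneE path_one path_zero.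
by rewrite ifT//; lra.
Qed.

Lemma conj_path1 u :
  conj_path (u, one) = path_cat (path_cat b a) (path_inv c) u.
Proof.
have u0 := ival_ge0 u; have u1 := ival_le1 u.
rewrite path_catE /conj_path /= ival1.
have [h|h] := leP (ival u) 2^-1.
  have E : ival (clamp (2 * ival u)) = 2 * ival u by rewrite clampE //; lra.
  rewrite path_catE E; case: (leP (2 * ival u) 2^-1) => h1.
    by rewrite ifT; [congr (b (clamp _))|]; lra.
  rewrite ifF; last by apply/negbTE; rewrite -ltNge; lra.
  rewrite ifT; last by lra.
  rewrite (_ : 1 - 3 / 4 * 1 = 4^-1) ?invrK; last by lra.
  by congr (a (clamp _)); lra.
rewrite ifF; last by apply/negbTE; rewrite -ltNge; lra.
rewrite ifF; last by apply/negbTE; rewrite -ltNge; lra.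
rewrite path_invE clampE; [|lra..].
by congr (c (clamp _)); lra.
Qed.

End Conjugation.

(** The families V and W let the left and right sides slide along the paths by
which bottom and top are conjugated. This one deformation replaces all
calculations in fundamental groupoids. *)
Theorem square_conj {x0 y0 x0' y0' x1 y1 x1' y1' : X}
    (a0 : {path I from x0 to y0 in X}) (b0 : {path I from x0' to x0 in X})
    (c0 : {path I from y0' to y0 in X}) (a1 : {path I from x1 to y1 in X})
    (b1 : {path I from x1' to x1 in X}) (c1 : {path I from y1' to y1 in X})
    (V W : I * I -> X) :
  continuous V -> continuous W ->
  (forall s, V (s, zero) = b0 s) -> (forall s, V (s, one) = b1 s) ->
  (forall s, W (s, zero) = c0 s) -> (forall s, W (s, one) = c1 s) ->
  square (fun t => V (zero, t)) (path_cat (path_cat b0 a0) (path_inv c0))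
    (path_cat (path_cat b1 a1) (path_inv c1)) (fun t => W (zero, t)) <->
  square (fun t => V (one, t)) a0 a1 (fun t => W (one, t)).
Proof.
move=> cV cW V0 V1 W0 W1.
have cf : continuous (fun w : I * I => (flipI w.2, w.1)).
  by apply: cts_pair; [exact: cts_comp cts_snd flipI_continuous|exact: cts_fst].
have := @square_deform_iff (fun w => V (flipI w.2, w.1))
  (fun w => W (flipI w.2, w.1)) (conj_path a0 b0 c0) (conj_path a1 b1 c1).
rewrite /= flipI0 flipI1.
have e0 x y x' y' a b c : (fun t => @conj_path x y x' y' a b c (t, zero)) = a.
  by apply/funext => t; exact: conj_path0.
have e1 x y x' y' a b c : (fun t => @conj_path x y x' y' a b c (t, one)) =
    path_cat (path_cat b a) (path_inv c).
  by apply/funext => t; exact: conj_path1.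
rewrite !e0 !e1; apply.
- exact: cts_comp cf cV.
- exact: cts_comp cf cW.
- exact: conj_path_continuous.
- exact: conj_path_continuous.
- by move=> s; rewrite conj_path_start V0.
- by move=> s; rewrite conj_path_start V1.
- by move=> s; rewrite conj_path_stop W0.
- by move=> s; rewrite conj_path_stop W1.
Qed.

End Squares.
(** * Cubes and disks *)

Section Cubes.
Context {R : realType} {n : nat}.
Local Notation I := (unit_interval R).
Implicit Types (x : cube R n) (y : 'rV[R]_n).

Lemma cts_row {S : topologicalType} (F : S -> 'rV[R]_n) :
  (forall j, continuous (fun s => F s ord0 j)) -> continuous F.
Proof.
move=> cF s A [P sP PA]; apply: (@filterS _ _ _
  [set s' | forall ij : 'I_1 * 'I_n, P ij.1 ij.2 (F s' ij.1 ij.2)]).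
  by move=> s' Ps'; apply: PA => i j; exact: (Ps' (i, j)).
apply: filter_forall => -[i j] /=; rewrite (ord1 i).
by apply: (cF j s); exact: sP.
Qed.

Lemma row_norm_le y (c : R) : 0 <= c -> `|y| <= c <-> forall i, `|y ord0 i| <= c.
Proof.
move=> c0; rewrite /Num.Def.normr /= mx_normrE; split=> [h i|h].
  by apply: le_trans h; apply: (le_bigmax _ (fun ij => `|y ij.1 ij.2|) (ord0, i)).
by apply/bigmax_leP; split=> // -[i j] _ /=; rewrite (ord1 i); exact: h.
Qed.

Lemma row_norm_attained y : `|y| != 0 -> exists i, `|y| = `|y ord0 i|.
Proof.
by move=> /mx_norm_neq0[[i j] /= e]; exists j; rewrite [LHS]e (ord1 i).
Qed.

Lemma coord_norm_le y i : `|y ord0 i| <= `|y|.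
Proof. by have /row_norm_le := lexx `|y|; apply. Qed.

Lemma cube_clamp_subproof y :
  (\row_i ival (clamp (y ord0 i)) : 'rV[R]_n) \in
    [set s : 'rV[R]_n | forall i, 0 <= s ord0 i <= 1].
Proof. by rewrite inE /= => i; rewrite mxE ival_ge0 ival_le1. Qed.

Definition cube_clamp y : cube R n :=
  exist (fun s => s \in [set s : 'rV[R]_n | forall i, 0 <= s ord0 i <= 1]) _
    (cube_clamp_subproof y).

Lemma cube_clampE y i : cube_val (cube_clamp y) ord0 i = ival (clamp (y ord0 i)).
Proof. by rewrite /cube_val /= ?set_valE /= mxE. Qed.

Lemma cube_val_inj : injective (@cube_val R n).
Proof. exact: val_inj. Qed.

Lemma cube_val_bound x i : 0 <= cube_val x ord0 i <= 1.
Proof. exact: (set_valP x). Qed.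

Lemma cube_val_continuous : continuous (@cube_val R n).
Proof. exact: initial_continuous. Qed.

Lemma cube_coord_continuous i : continuous (fun x => cube_val x ord0 i).
Proof. exact: cts_comp cube_val_continuous (@coord_continuous _ _ _ ord0 i). Qed.

Lemma cube_clamp_continuous : continuous cube_clamp.
Proof.
apply: continuous_comp_initial; apply: cts_row => j.
have -> : (fun s => (set_val \o cube_clamp) s ord0 j) =
    (fun y => ival (clamp (y ord0 j))).
  by apply/funext => y; exact: cube_clampE.
exact/cts_ival/cts_clamp/coord_continuous.
Qed.

Definition center x : 'rV[R]_n := \row_j (2 * cube_val x ord0 j - 1).
Definition uncenter y : cube R n := cube_clamp (\row_j (2^-1 * (y ord0 j + 1))).

Lemma center_continuous : continuous center.
Proof.
apply: cts_row => j.
have -> : (fun x => center x ord0 j) = (fun x => 2 * cube_val x ord0 j - 1).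
  by apply/funext => x; rewrite mxE.
apply: cts_addr; last exact: cts_cst.
by apply: cts_mulr; [exact: cts_cst|exact: cube_coord_continuous].
Qed.

Lemma uncenter_continuous : continuous uncenter.
Proof.
apply: cts_comp cube_clamp_continuous; apply: cts_row => j.
have -> : (fun y : 'rV[R]_n => (\row_j (2^-1 * (y ord0 j + 1)) : 'rV[R]_n) ord0 j) =
    (fun y => 2^-1 * (y ord0 j + 1)).
  by apply/funext => y; rewrite mxE.
apply: cts_mulr; first exact: cts_cst.
by apply: cts_addr; [exact: coord_continuous|exact: cts_cst].
Qed.

Lemma center_norm x : `|center x| <= 1.
Proof.
apply/row_norm_le => // i; have /andP[h h'] := cube_val_bound x i.
by rewrite mxE ler_norml; apply/andP; split; lra.
Qed.

Lemma uncenterK y : `|y| <= 1 -> center (uncenter y) = y.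
Proof.
move=> /row_norm_le h; apply/rowP => i; have := h ler01 i.
rewrite ler_norml => /andP[h1 h2].
by rewrite mxE cube_clampE mxE clampE; lra.
Qed.

Lemma centerK : cancel center uncenter.
Proof.
move=> x; apply/cube_val_inj/rowP => i; have /andP[h h'] := cube_val_bound x i.
by rewrite cube_clampE !mxE clampE; lra.
Qed.

Lemma boundary_center x : cube_boundary x <-> `|center x| = 1.
Proof.
split=> [[i xi]|h].
  apply/eqP; rewrite eq_le center_norm /= (le_trans _ (coord_norm_le _ i))//.
  rewrite mxE; case: xi => ->; first by rewrite mulr0 sub0r normrN1.
  by rewrite mulr1 ger0_norm; lra.
have [|i] := @row_norm_attained (center x); first by rewrite h oner_neq0.
rewrite h mxE => e; exists i; move: e.
by case: (ler0P (2 * cube_val x ord0 i - 1)) => _ e; [left|right]; lra.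
Qed.

Definition cube_ball : ball_space R (cube R n).
Proof.
apply: (@BallSpace _ _ (fun x => `|center x|)
  (fun k x => uncenter (k *: center x))).
- exact: cts_comp center_continuous (@norm_continuous _ _).
- apply: cts_comp uncenter_continuous => kx.
  apply: cvgZ; first exact: cts_fst.
  exact: (cts_comp cts_snd center_continuous).
- by move=> z; exact: normr_ge0.
- exact: center_norm.
- by move=> k z k0 kz; rewrite uncenterK normrZ (ger0_norm k0).
- by move=> z; rewrite scale1r centerK.
- by move=> z z'; rewrite !scale0r.
Defined.

Lemma rim_cube x : rim cube_ball x <-> cube_boundary x.
Proof. by rewrite boundary_center. Qed.

Definition eucl y : R := Num.sqrt (\sum_i y ord0 i ^+ 2).

Lemma eucl_sum_ge0 y : 0 <= \sum_i y ord0 i ^+ 2.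
Proof. by apply: sumr_ge0 => i _; exact: sqr_ge0. Qed.

Lemma eucl_sqr y : eucl y ^+ 2 = \sum_i y ord0 i ^+ 2.
Proof. by rewrite sqr_sqrtr// eucl_sum_ge0. Qed.

Lemma eucl_ge0 y : 0 <= eucl y. Proof. exact: sqrtr_ge0. Qed.

Lemma eucl_scale (k : R) y : 0 <= k -> eucl (k *: y) = k * eucl y.
Proof.
move=> k0; apply/eqP; rewrite -(@eqrXn2 _ 2)// ?eucl_ge0 ?mulr_ge0 ?eucl_ge0//.
rewrite exprMn !eucl_sqr mulr_sumr; apply/eqP/eq_bigr => i _.
by rewrite mxE exprMn.
Qed.

Lemma norm_le_eucl y : `|y| <= eucl y.
Proof.
apply/row_norm_le => [|i]; first exact: eucl_ge0.
rewrite -(@ler_pXn2r _ 2)// ?nnegrE ?eucl_ge0// eucl_sqr real_normK ?num_real//.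
by rewrite (bigD1 i)//= lerDl; apply: sumr_ge0 => j _; exact: sqr_ge0.
Qed.

Lemma eucl_le_norm y : eucl y <= n%:R * `|y|.
Proof.
rewrite -(@ler_pXn2r _ 2)// ?nnegrE ?eucl_ge0 ?mulr_ge0 ?ler0n// eucl_sqr.
apply: (@le_trans _ _ (\sum_(i < n) `|y| ^+ 2)).
  apply: ler_sum => i _; rewrite -[leLHS]real_normK ?num_real//.
  by rewrite ler_pXn2r ?nnegrE// coord_norm_le.
rewrite sumr_const card_ord -[leLHS]mulr_natl exprMn ler_wpM2r ?sqr_ge0//.
by rewrite -natrX ler_nat; case: (n) => // m; rewrite -mulnn leq_pmulr.
Qed.

Lemma eucl_continuous : continuous eucl.
Proof.
apply: cts_comp (@sqrt_continuous R); elim: (index_enum _) => [|i s IHs].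
  by under eq_fun do rewrite big_nil; exact: cts_cst.
under eq_fun do rewrite big_cons; apply: cts_addr IHs.
by under eq_fun do rewrite expr2; apply: cts_mulr; exact: coord_continuous.
Qed.

Lemma eucl_eq0 y : eucl y = 0 -> y = 0.
Proof.
move=> e; apply/eqP; rewrite -normr_eq0; apply/eqP/le_anti.
by rewrite normr_ge0 -{1}e norm_le_eucl.
Qed.

(** Boundedness of g gives continuity at the origin, where g itself may jump. *)
Lemma scaling_continuous (g : 'rV[R]_n -> R) (C : R) :
  (forall y, y != 0 -> {for y, continuous g}) -> (forall y, `|g y| <= C) ->
  continuous (fun y => g y *: y).
Proof.
move=> cg gC y; have [->|y0] := eqVneq y 0; last first.
  by apply: cvgZ; [exact: nbhs_filter|exact: (cg y y0)|exact: cvg_id].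
suff h : (fun z : 'rV[R]_n => `|g z *: z|) @ (0 : 'rV[R]_n) --> (0 : R).
  by rewrite /continuous_at scaler0; exact: (norm_cvg0 h).
apply: (@squeeze_cvgr _ _ (nbhs_filter (0 : 'rV[R]_n)) R (cst 0)
  (fun z => C * `|z|) (fun z => `|g z *: z|)).
- apply: nearW => z; rewrite normr_ge0 normrZ /=.
  by rewrite ler_wpM2r.
- exact: cvg_cst.
- have -> : (0 : R) = C * `|0 : 'rV[R]_n| by rewrite normr0 mulr0.
  apply: (cts_mulr (f := fun=> C)); first exact: cts_cst.
  exact: norm_continuous.
Qed.

(** Radial homeomorphism from the ball of the sup norm to the Euclidean ball. At
the origin the ratio is 0 / 0 = 0, which is harmless. *)
Definition to_round y : 'rV[R]_n := (`|y| / eucl y) *: y.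
Definition to_square y : 'rV[R]_n := (eucl y / `|y|) *: y.

Lemma to_round_continuous : continuous to_round.
Proof.
apply: (@scaling_continuous _ 1) => [y y0|y].
  apply: cvgM; [exact: nbhs_filter|exact: norm_continuous|].
  apply: cvgV; [exact: nbhs_filter| |exact: eucl_continuous].
  by apply: contra_neq y0; exact: eucl_eq0.
rewrite ger0_norm ?divr_ge0 ?eucl_ge0//.
have [->|e0] := eqVneq (eucl y) 0; first by rewrite invr0 mulr0.
by rewrite ler_pdivrMr ?mul1r ?norm_le_eucl// lt_def e0 eucl_ge0.
Qed.

Lemma to_square_continuous : continuous to_square.
Proof.
apply: (@scaling_continuous _ n%:R) => [y y0|y].
  apply: cvgM; [exact: nbhs_filter|exact: eucl_continuous|].
  by apply: cvgV; [exact: nbhs_filter|rewrite normr_eq0|exact: norm_continuous].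
rewrite ger0_norm ?divr_ge0 ?eucl_ge0//.
have [->|e0] := eqVneq `|y| 0; first by rewrite invr0 mulr0.
by rewrite ler_pdivrMr ?eucl_le_norm// lt_def e0 normr_ge0.
Qed.

Lemma to_roundK : cancel to_round to_square.
Proof.
move=> y; have [->|y0] := eqVneq y 0; first by rewrite /to_round /to_square !scaler0.
have n0 : `|y| != 0 by rewrite normr_eq0.
have e0 : eucl y != 0 by apply: contra_neq y0; exact: eucl_eq0.
have k0 : 0 <= `|y| / eucl y by rewrite divr_ge0 ?eucl_ge0.
rewrite /to_square eucl_scale// normrZ (ger0_norm k0) /to_round scalerA.
rewrite -[RHS]scale1r; congr (_ *: _).
by field; rewrite n0 e0.
Qed.

Lemma to_squareK : cancel to_square to_round.
Proof.
move=> y; have [->|y0] := eqVneq y 0; first by rewrite /to_round /to_square !scaler0.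
have n0 : `|y| != 0 by rewrite normr_eq0.
have e0 : eucl y != 0 by apply: contra_neq y0; exact: eucl_eq0.
have k0 : 0 <= eucl y / `|y| by rewrite divr_ge0 ?eucl_ge0.
rewrite /to_round eucl_scale// normrZ (ger0_norm k0) /to_square scalerA.
rewrite -[RHS]scale1r; congr (_ *: _).
by field; rewrite n0 e0.
Qed.

Lemma eucl_to_round y : eucl (to_round y) = `|y|.
Proof.
have [->|y0] := eqVneq y 0.
  by rewrite /to_round scaler0 normr0; apply/le_anti; rewrite eucl_ge0 andbT
    (le_trans (eucl_le_norm _))// normr0 mulr0.
have e0 : eucl y != 0 by apply: contra_neq y0; exact: eucl_eq0.
by rewrite eucl_scale ?divr_ge0 ?eucl_ge0// divfK.
Qed.

Lemma norm_to_square y : `|to_square y| = eucl y.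
Proof. by rewrite -eucl_to_round to_squareK. Qed.

Lemma disk_valE (d : disk R n) : \sum_i disk_val d ord0 i ^+ 2 <= 1.
Proof. exact: (set_valP d). Qed.

Lemma cube_disk_subproof x :
  to_round (center x) \in [set s : 'rV[R]_n | \sum_i s ord0 i ^+ 2 <= 1].
Proof. by rewrite inE /= -eucl_sqr eucl_to_round exprn_ile1 ?center_norm. Qed.

Definition cube_disk x : disk R n :=
  exist (fun s => s \in [set s : 'rV[R]_n | \sum_i s ord0 i ^+ 2 <= 1]) _
    (cube_disk_subproof x).

Definition disk_cube (d : disk R n) : cube R n := uncenter (to_square (disk_val d)).

Lemma cube_diskE x : disk_val (cube_disk x) = to_round (center x).
Proof. by rewrite /disk_val /= ?set_valE. Qed.

Lemma cube_disk_continuous : continuous cube_disk.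
Proof.
apply: continuous_comp_initial.
have -> : set_val \o cube_disk = to_round \o center.
  by apply/funext => x; exact: cube_diskE.
exact: cts_comp center_continuous to_round_continuous.
Qed.

Lemma disk_cube_continuous : continuous disk_cube.
Proof.
apply: cts_comp uncenter_continuous; apply: cts_comp to_square_continuous.
exact: initial_continuous.
Qed.

Lemma cube_diskK : cancel cube_disk disk_cube.
Proof. by move=> x; rewrite /disk_cube cube_diskE to_roundK centerK. Qed.

Lemma disk_cubeK : cancel disk_cube cube_disk.
Proof.
move=> d; apply: val_inj.
have <- : disk_val (cube_disk (disk_cube d)) = val (cube_disk (disk_cube d)) by [].
rewrite cube_diskE uncenterK ?to_squareK// norm_to_square.
by rewrite -(@ler_pXn2r _ 2)// ?nnegrE ?eucl_ge0// eucl_sqr expr1n disk_valE.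
Qed.

Lemma cube_disk_interior x : disk_interior (cube_disk x) <-> ~ cube_boundary x.
Proof.
rewrite boundary_center /disk_interior /= cube_diskE -eucl_sqr eucl_to_round.
have c1 := center_norm x; have c0 := normr_ge0 (center x).
split=> [h e|h]; first by move: h; rewrite e expr1n ltxx.
have c1' : `|center x| < 1 by rewrite lt_neqAle c1 andbT; apply/eqP.
by rewrite exprn_ilt1.
Qed.

Lemma cube_disk_sphere x : cube_boundary x -> disk_sphere (cube_disk x).
Proof.
move=> /boundary_center e.
by rewrite /disk_sphere /= cube_diskE -eucl_sqr eucl_to_round e expr1n.
Qed.

Lemma cube_compact : compact [set: cube R n].
Proof.
have cseg : compact [set s : 'rV[R]_n | forall i, `[0, 1]%classic (s ord0 i)].
  exact: (@rV_compact R n (fun=> `[0, 1]%classic) (fun=> @segment_compact R 0 1)).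
have : compact (cube_clamp @` [set s : 'rV[R]_n | forall i, `[0, 1]%classic (s ord0 i)]).
  apply: continuous_compact => //.
  exact/continuous_subspaceT/cube_clamp_continuous.
congr compact; apply/seteqP; split=> // x _; exists (cube_val x).
  by move=> i; rewrite /= in_itv /=; exact: cube_val_bound.
apply/cube_val_inj/rowP => i; rewrite cube_clampE clampE//.
  by case/andP: (cube_val_bound x i).
by case/andP: (cube_val_bound x i).
Qed.

Lemma spheroid_null {X : topologicalType} (x0 : X) (s : cube R n -> X) :
  (forall u v : pi_set R n x0, u = v) -> continuous s ->
  (forall z, cube_boundary z -> s z = x0) ->
  homotopic_rel R cube_boundary (fun=> x0) s.
Proof.
move=> pi_triv cs sx.
pose sc : continuousType (cube R n) X :=
  HB.pack s (isContinuous.Build _ _ s cs).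
pose kc : continuousType (cube R n) X := cst x0.
have sP : sc \in @spheroids R X n x0 by rewrite inE.
have kP : kc \in @spheroids R X n x0 by rewrite inE.
pose k' : @spheroids R X n x0 := exist _ kc kP.
pose s' : @spheroids R X n x0 := exist _ sc sP.
have := pi_triv (\pi_({eq_quot (@spheroid_equiv R X n x0)}) k')
  (\pi_({eq_quot (@spheroid_equiv R X n x0)}) s').
by move=> /eqquotP /asboolP.
Qed.

End Cubes.
(** * Filling spheres in aspherical spaces *)

Section AsphericalCubes.
Context {R : realType} {X : topologicalType}.
Local Notation I := (unit_interval R).

Lemma fills_aspherical (n : nat) :
  (forall (x : X) (u v : pi_set R n x), u = v) ->
  fills (product_ball (@cube_ball R n) interval_ball) X.
Proof.
move=> pi_triv; apply: fills_cylinder => x s cs sx.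
have [|H [cH H0 H1 HA]] := spheroid_null (pi_triv x) cs.
  by move=> z /rim_cube; exact: sx.
by exists H; split=> // z t /rim_cube; exact: HA.
Qed.

Definition cube_of_square (w : I * I) : cube R 2 :=
  cube_clamp (\row_j if j == ord0 then ival w.1 else ival w.2).

Definition square_of_cube (x : cube R 2) : I * I :=
  (clamp (cube_val x ord0 ord0), clamp (cube_val x ord0 ord_max)).

Lemma cube_of_squareE w j :
  cube_val (cube_of_square w) ord0 j = if j == ord0 then ival w.1 else ival w.2.
Proof. by rewrite cube_clampE mxE; case: ifP; rewrite ivalK. Qed.

Lemma cube_of_squareK : cancel cube_of_square square_of_cube.
Proof.
by move=> [u t]; rewrite /square_of_cube !cube_of_squareE eqxx /= !ivalK.
Qed.

Lemma cube_of_square_continuous : continuous cube_of_square.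
Proof.
apply: cts_comp cube_clamp_continuous; apply: cts_row => j.
under eq_fun do rewrite mxE.
by case: (j == ord0); apply: cts_ival; [exact: cts_fst|exact: cts_snd].
Qed.

Lemma square_of_cube_continuous : continuous square_of_cube.
Proof. by apply: cts_pair; apply: cts_clamp; exact: cube_coord_continuous. Qed.

Lemma rim_cube_of_square w :
  rim (@cube_ball R 2) (cube_of_square w) <->
  rim (product_ball interval_ball interval_ball) w.
Proof.
rewrite rim_cube rim_prod !rim_interval !zeroP !oneP; split=> [[j]|].
  by rewrite cube_of_squareE; case: ifP => _ h; [left|right].
case=> h; [exists ord0|exists ord_max]; rewrite cube_of_squareE ?eqxx//.
Qed.

Lemma square_of_cubeK : cancel square_of_cube cube_of_square.
Proof.
move=> x; apply/cube_val_inj/rowP => j; rewrite cube_of_squareE.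
have cE i : ival (clamp (cube_val x ord0 i)) = cube_val x ord0 i.
  by rewrite clampE//; have /andP[] := cube_val_bound x i.
case: eqP => [->|/eqP j0]; rewrite cE//; congr (cube_val _ _ _).
by apply/val_inj => /=; case: j j0 => [[|[|]]].
Qed.

(** Lifts over an edge live on a product of two intervals, whereas the second
homotopy group is defined through the cube of row vectors; the two are the same
ball. *)
Lemma fills_cube_of_square :
  (forall (x : X) (u v : pi_set R 2 x), u = v) ->
  fills (product_ball (product_ball interval_ball interval_ball)
    (@interval_ball R)) X.
Proof.
move=> /fills_aspherical; apply: (@fills_transfer R _ _ X _ _
  (fun w => (cube_of_square w.1, w.2)) (fun w => (square_of_cube w.1, w.2))).
- apply: cts_pair; last exact: cts_snd.
  exact: cts_comp cts_fst cube_of_square_continuous.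
- apply: cts_pair; last exact: cts_snd.
  exact: cts_comp cts_fst square_of_cube_continuous.
- by move=> [w t] /=; rewrite cube_of_squareK.
- move=> w /rim_prod h; apply/rim_prod; case: h => h; [left|by right].
  exact/rim_cube_of_square.
- move=> w /rim_prod h; apply/rim_prod; case: h => h; [left|by right].
  by apply/rim_cube_of_square; rewrite square_of_cubeK.
Qed.

End AsphericalCubes.

Section SegmentCube.
Context {R : realType}.
Local Notation I := (unit_interval R).

Definition cube_of_segment (t : I) : cube R 1 := cube_clamp (\row__ ival t).
Definition segment_of_cube (x : cube R 1) : I := clamp (cube_val x ord0 ord0).

Lemma cube_of_segment_continuous : continuous cube_of_segment.
Proof.
apply: cts_comp cube_clamp_continuous; apply: cts_row => j.
by under eq_fun do rewrite mxE; exact: ival_continuous.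
Qed.

Lemma segment_of_cube_continuous : continuous segment_of_cube.
Proof. exact/cts_clamp/cube_coord_continuous. Qed.

Lemma cube_of_segmentE t j : cube_val (cube_of_segment t) ord0 j = ival t.
Proof. by rewrite cube_clampE mxE ivalK. Qed.

Lemma segment_of_cubeK : cancel segment_of_cube cube_of_segment.
Proof.
move=> x; apply/cube_val_inj/rowP => j; rewrite cube_of_segmentE (ord1 j).
by rewrite clampE//; have /andP[] := cube_val_bound x ord0.
Qed.

Lemma boundary_cube_of_segment t :
  cube_boundary (cube_of_segment t) <-> t = zero \/ t = one.
Proof.
rewrite zeroP oneP; split=> [[j]|h]; first by rewrite cube_of_segmentE.
by exists ord0; rewrite cube_of_segmentE.
Qed.

End SegmentCube.

(** * Lifting over a single cell *)

Section Admissible.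
Context {R : realType} {M N B : topologicalType}.
Local Notation I := (unit_interval R).
Context (p : continuousType M B) (q : continuousType N B).
Context (f g : continuousType M N) (m1 : M).
Context (delta : {path I from f m1 to g m1 in N}).

(** The paths that arise from delta by transport along some path from m1. *)
Definition admissible (x : M) (k : I -> N) : Prop :=
  exists a : {path I from m1 to x in M}, square delta (f \o a) (g \o a) k.

Hypothesis loops : forall l : {path I from m1 to m1 in M},
  square delta (f \o l) (g \o l) delta.

Lemma comp_conj (h : continuousType M N) {x y x' y' : M}
    (a : {path I from x to y in M}) (b : {path I from x' to x in M})
    (c : {path I from y' to y in M}) :
  h \o path_cat (path_cat b a) (path_inv c) =1
  path_cat (path_cat (h \o b : {path I from h x' to h x in N})
    (h \o a : {path I from h x to h y in N}))
    (path_inv (h \o c : {path I from h y' to h y in N})).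
Proof.
move=> t; rewrite path_catE [LHS]/(h _) path_catE.
case: ifP => _; last by [].
by rewrite !path_catE; case: ifP.
Qed.

(** Transport along the path to x, along a, and back along the path to y is
transport around a loop at m1, which preserves delta by hypothesis. Shrinking the
outer two paths leaves a square over a alone. *)
Lemma admissible_square (x y : M) (k k' : I -> N) (a : {path I from x to y in M}) :
  admissible x k -> admissible y k' -> square k (f \o a) (g \o a) k'.
Proof.
move=> [b [V [cV V0 V1 Vf Vg]]] [c [W [cW W0 W1 Wf Wg]]].
have [+ _] := square_conj
  (b0 := f \o b : {path I from f m1 to f x in N})
  (c0 := f \o c : {path I from f m1 to f y in N})
  (b1 := g \o b : {path I from g m1 to g x in N})
  (c1 := g \o c : {path I from g m1 to g y in N})
  (f \o a : {path I from f x to f y in N})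
  (g \o a : {path I from g x to g y in N}) cV cW Vf Vg Wf Wg.
move=> D; apply: square_eq (D _) => //.
by apply: square_eq (loops (path_cat (path_cat b a) (path_inv c))) => //;
  exact: comp_conj.
Qed.

Hypotheses (q_fib : hurewicz_fibration R q).
Hypotheses (f_over : q \o f =1 p) (g_over : q \o g =1 p).
Hypothesis delta_over : forall t, q (delta t) = p m1.

(** Transport carried out by relative lifting, so that the resulting path lies
in the fiber over p x. *)
Lemma admissible_exists (x : M) : path_connected R M ->
  exists k : I -> N, [/\ continuous k, forall t, q (k t) = p x,
    k zero = f x, k one = g x & admissible x k].
Proof.
move=> [_ /(_ m1 x)[a]].
(* The box over a: delta at its start, f a below and g a above; its missing side
   is the transported path. *)
pose side (w : I * I) := if w.1 == zero then f (a w.2) else g (a w.2).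
have side0 s : side (zero, s) = f (a s) by rewrite /side /= eqxx.
have side1 s : side (one, s) = g (a s).
  by rewrite /side /=; case: eqP => // /one_neq_zero.
have ca (h : continuousType M N) : continuous (fun w : I * I => h (a w.2)).
  apply: cts_comp (@cts_fun _ _ h); apply: cts_comp (@cts_fun _ _ a).
  exact: cts_snd.
have [||t|t|w|H [cH qH H0 Hs]] := @rel_lift R _ interval_ball _ _ q
    (fun w => p (a w.2)) delta side q_fib _ (@cts_fun _ _ delta).
- apply: cts_comp (@cts_fun _ _ p); apply: cts_comp (@cts_fun _ _ a).
  exact: cts_snd.
- have -> : [set w : I * I | rim interval_ball w.1] =
      [set w | w.1 = zero] `|` [set w | w.1 = one].
    by apply/seteqP; split=> w /= /rim_interval.
  apply: cts_on_setU.
    apply: (@cts_on_eq _ _ _ (fun w => f (a w.2))) => [[u s] /= ->|].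
      by rewrite side0.
    by apply: cts_on_continuous (ca f); apply: closed_slice; exact: cts_fst.
  apply: (@cts_on_eq _ _ _ (fun w => g (a w.2))) => [[u s] /= ->|].
    by rewrite side1.
  by apply: cts_on_continuous (ca g); apply: closed_slice; exact: cts_fst.
- by case/rim_interval => ->; rewrite ?side0 ?side1 !path_zero ?path_one.
- by rewrite delta_over /= path_zero.
- case: w => u s /rim_interval[] /= ->; rewrite ?side0 ?side1.
    exact: f_over.
  exact: g_over.
have r0 : rim (@interval_ball R) zero by apply/rim_interval; left.
have r1 : rim (@interval_ball R) one by apply/rim_interval; right.
exists (fun t => H (t, one)); split.
- apply: cts_comp cH; apply: cts_pair; [exact: cts_id|exact: cts_cst].
- by move=> t; rewrite qH /= path_one.
- by rewrite Hs// side0 path_one.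
- by rewrite Hs// side1 path_one.
exists a, (fun w => H (w.2, w.1)); split=> // [|s|s].
- by apply: cts_comp cH; apply: cts_pair; [exact: cts_snd|exact: cts_fst].
- by rewrite Hs// side0.
- by rewrite Hs// side1.
Qed.

(** A filling exists in N by admissibility at the two ends; it is then moved over
the edge, which is where pi_2(B) = 0 enters. *)
Lemma edge_lift (x y : M) (k k' : I -> N) (a : {path I from x to y in M}) :
  (forall (b : B) (u v : pi_set R 2 b), u = v) ->
  admissible x k -> admissible y k' ->
  (forall t, q (k t) = p x) -> (forall t, q (k' t) = p y) ->
  exists K : I * I -> N, [/\ continuous K, forall w, q (K w) = p (a w.1) &
    [/\ forall t, K (zero, t) = k t, forall t, K (one, t) = k' t,
      forall s, K (s, zero) = f (a s) & forall s, K (s, one) = g (a s)]].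
Proof.
move=> pi2 xk yk' qk qk'.
have [K [cK Kl Kr Kf Kg]] := admissible_square a xk yk'.
pose b2 : ball_space R (I * I)%type := product_ball interval_ball interval_ball.
have rimE (w : I * I) : rim b2 w <-> (w.1 = zero \/ w.1 = one) \/ (w.2 = zero \/ w.2 = one).
  by rewrite rim_prod !rim_interval.
have [|w|L [cL qL LK]] := @lift_correction R _ _ _ b2 q K (fun w => p (a w.1))
    q_fib (fills_cube_of_square pi2) cK.
- apply: cts_comp (@cts_fun _ _ p); apply: cts_comp (@cts_fun _ _ a).
  exact: cts_fst.
- case: w => s t /rimE /= [[]|[]] ->; rewrite ?Kl ?Kr ?Kf ?Kg ?qk ?qk' /=.
  + by rewrite path_zero.
  + by rewrite path_one.
  + exact: f_over.
  + exact: g_over.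
exists L; split=> //; split=> t; rewrite LK ?Kl ?Kr ?Kf ?Kg//; apply/rimE => /=; tauto.
Qed.

Hypothesis M_pc : path_connected R M.
Hypotheses (B_K : is_K_pi_1 R B) (S_K : is_K_pi_1 R (fiber q (p m1))).

(** Vertices receive a transported path, edges are filled because the paths at
their ends are admissible, and from dimension 2 on the obstruction lies in a
homotopy group of the fiber that vanishes. *)
Lemma cell_lift (n : nat) (chi : cube R n -> M) (F : cube R n * I -> N) :
  continuous chi -> cts_on (rim (product_ball (@cube_ball R n) interval_ball)) F ->
  (forall w, rim (product_ball (@cube_ball R n) interval_ball) w ->
    q (F w) = p (chi w.1)) ->
  (forall s, F (s, zero) = f (chi s)) -> (forall s, F (s, one) = g (chi s)) ->
  (n = 1 -> forall s, cube_boundary s -> admissible (chi s) (fun t => F (s, t))) ->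
  exists L : cube R n * I -> N, [/\ continuous L, forall w, q (L w) = p (chi w.1),
    forall w, rim (product_ball (@cube_ball R n) interval_ball) w -> L w = F w &
    n = 0 -> forall s, admissible (chi s) (fun t => L (s, t))].
Proof.
case: n chi F => [|[|n]] chi F cchi cF qF F0 F1 adm.
- have pt (s s' : cube R 0) : s = s'.
    by apply/cube_val_inj/rowP => -[].
  pose o : cube R 0 := cube_clamp 0.
  have [k [ck qk k0 k1 ka]] := admissible_exists (chi o) M_pc.
  exists (fun w => k w.2); split=> [|w|[s t]|_ s]; rewrite ?(pt s o)//.
  + exact: cts_comp cts_snd ck.
  + by rewrite qk (pt w.1 o).
  + case/rim_prod => [/rim_cube[[]]//|/rim_interval[] /= ->].
      by rewrite k0 F0.
    by rewrite k1 F1.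
- have ca : continuous (fun t => chi (cube_of_segment t)).
    exact: cts_comp cube_of_segment_continuous cchi.
  pose a : {path I from chi (cube_of_segment zero) to chi (cube_of_segment one) in M} :=
    mk_path ca erefl erefl.
  have aE s : a (segment_of_cube s) = chi s by rewrite -[in RHS](segment_of_cubeK s).
  have [bd0 bd1] : cube_boundary (@cube_of_segment R zero) /\
      cube_boundary (@cube_of_segment R one).
    by split; apply/boundary_cube_of_segment; [left|right].
  have side s t : cube_boundary s -> q (F (s, t)) = p (chi s).
    by move=> bs; rewrite qF//; apply/rim_prod; left; exact/rim_cube.
  have [|t|t|K [cK qK [K0 K1 Kf Kg]]] := @edge_lift _ _ _ _ a
      _ (adm erefl _ bd0) (adm erefl _ bd1).
  + by move=> b u v; case: B_K => _; apply.
  + exact: side.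
  + exact: side.
  exists (fun w => K (segment_of_cube w.1, w.2)); split=> //.
  + apply: cts_comp cK; apply: cts_pair; last exact: cts_snd.
    exact: cts_comp cts_fst segment_of_cube_continuous.
  + by move=> w; rewrite qK /= aE.
  + case=> s t /rim_prod[/rim_cube|/rim_interval] /=.
      rewrite -{1}(segment_of_cubeK s) => /boundary_cube_of_segment e.
      by case: e (segment_of_cubeK s) => -> <-; rewrite ?K0 ?K1.
    by case=> ->; rewrite ?Kf ?Kg aE ?F0 ?F1.
- have [||w rw|L [cL qL LF]] := @fiber_lift R _ (@cube_ball R n.+2) _ _ q (p m1)
    (fun w => p (chi w.1)) F q_fib B_K.1 S_K.1.1 _ _ cF.
  + by apply: fills_aspherical; case: S_K => _; apply.
  + apply: cts_comp (@cts_fun _ _ p); exact: cts_comp cts_fst cchi.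
  + exact: qF.
  by exists L.
Qed.

End Admissible.
(** * Gluing along the cells of a CW complex *)

Lemma hausdorff_pair (S T : topologicalType) :
  hausdorff_space S -> hausdorff_space T -> hausdorff_space (S * T)%type.
Proof.
move=> hS hT [x y] [x' y'] cl; congr (_, _).
  apply: hS => A A' xA xA'.
  by have [||[u v] [/= Au A'u]] := cl (fst @^-1` A) (fst @^-1` A');
    [exact: (@cts_fst _ _ (x, y) _ xA)|exact: (@cts_fst _ _ (x', y') _ xA')|exists u].
apply: hT => A A' yA yA'.
by have [||[u v] [/= Av A'v]] := cl (snd @^-1` A) (snd @^-1` A');
  [exact: (@cts_snd _ _ (x, y) _ yA)|exact: (@cts_snd _ _ (x', y') _ yA')|exists v].
Qed.

Section UnitIntervalTopology.
Context {R : realType}.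
Local Notation I := (unit_interval R).

Lemma unit_interval_compact : compact [set: I].
Proof.
have : compact ((@clamp R) @` `[0, 1]%classic).
  apply: continuous_compact; last exact: segment_compact.
  exact/continuous_subspaceT/clamp_continuous.
congr compact; apply/seteqP; split=> // t _; exists (ival t); last exact: ivalK.
by rewrite /= in_itv /= ival_ge0 ival_le1.
Qed.

Lemma unit_interval_hausdorff : hausdorff_space I.
Proof.
move=> s t cl; apply: ival_inj; apply: Rhausdorff => A A' sA tA'.
by have [||u [/= Au A'u]] := cl (ival @^-1` A) (ival @^-1` A');
  [exact: (@ival_continuous R s _ sA)|exact: (@ival_continuous R t _ tA')|exists (ival u)].
Qed.

Lemma unit_interval_locally_compact : locally_compact [set: I].
Proof.
move=> t _; exists setT; first exact: filterT.
by split; [exact: unit_interval_compact|exact: closedT].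
Qed.

End UnitIntervalTopology.

Section CubicalCells.
Context {R : realType} {M : topologicalType} (cw : cw_structure R M).
Local Notation I := (unit_interval R).
Local Notation C := (cell cw).
Local Notation dim := (@cell_dim R M cw).

(** Characteristic maps are precomposed with the homeomorphism from the cube to
the disk, since homotopy groups and balls are set up on cubes. *)
Definition cube_map (e : C) (s : cube R (dim e)) : M := char_map (cube_disk s).

Lemma cube_map_continuous e : continuous (@cube_map e).
Proof. exact: cts_comp cube_disk_continuous (@char_map_continuous _ _ _ e). Qed.

Definition cell_of (x : M) : C :=
  projT1 (cid (cells_partition cw x)).

Lemma cell_ofP x : (@char_map _ _ cw (cell_of x) @` disk_interior) x.
Proof. by rewrite /cell_of; case: cid => e /= []. Qed.

Lemma cell_of_unique e x : (@char_map _ _ cw e @` disk_interior) x -> cell_of x = e.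
Proof. by rewrite /cell_of; case: cid => e' /= [_]; apply. Qed.

Lemma cell_of_interior e (s : cube R (dim e)) :
  ~ cube_boundary s -> cell_of (cube_map s) = e.
Proof.
by move=> bs; apply: cell_of_unique; exists (cube_disk s) => //; exact/cube_disk_interior.
Qed.

Lemma cube_map_inj e (s s' : cube R (dim e)) :
  ~ cube_boundary s -> ~ cube_boundary s' -> cube_map s = cube_map s' -> s = s'.
Proof.
move=> bs bs' /char_map_inj h; apply: (can_inj cube_diskK).
by apply: h; exact/cube_disk_interior.
Qed.

Lemma cube_map_onto x :
  exists2 s : cube R (dim (cell_of x)), ~ cube_boundary s & cube_map s = x.
Proof.
have [d di dx] := cell_ofP x; exists (disk_cube d).
  by apply/cube_disk_interior; rewrite disk_cubeK.
by rewrite /cube_map disk_cubeK.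
Qed.

Lemma cube_map_boundary e : exists F : set C, [/\ finite_set F,
  forall e', F e' -> (dim e' < dim e)%N &
  forall s : cube R (dim e), cube_boundary s -> F (cell_of (cube_map s))].
Proof.
have [F [finF ltF subF]] := closure_finite e; exists F; split=> // s bs.
have [|e' Fe' e's] := subF (cube_map s).
  by exists (cube_disk s) => //; exact: cube_disk_sphere.
by rewrite (cell_of_unique e's).
Qed.

Lemma dim_boundary e (s : cube R (dim e)) :
  cube_boundary s -> (dim (cell_of (cube_map s)) < dim e)%N.
Proof. by have [F [_ ltF bF]] := cube_map_boundary e; move/bF/ltF. Qed.

Lemma dim_cube_map e (s : cube R (dim e)) : (dim (cell_of (cube_map s)) <= dim e)%N.
Proof.
have [/dim_boundary/ltnW//|bs] := pselect (cube_boundary s).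
by rewrite cell_of_interior.
Qed.

Lemma weak_topology_cubes (A : set M) :
  (forall e, closed (@cube_map e @^-1` A)) -> closed A.
Proof.
move=> cA; apply/(weak_topology cw) => e.
have /continuous_closedP cd := @disk_cube_continuous R (dim e).
have := cd _ (cA e); congr closed; apply/seteqP; split=> d /=;
  by rewrite /cube_map disk_cubeK.
Qed.

Section Homotopies.
Context {N : topologicalType}.

Definition on_cell (H : M * I -> N) e (w : cube R (dim e) * I) : N :=
  H (cube_map w.1, w.2).

(** A homotopy is a map from M to the space of paths in N with the compact-open
topology, for which the weak topology of M decides continuity. As the interval is
compact, continuity of that map gives back joint continuity. *)
Lemma homotopy_continuous (H : M * I -> N) :
  (forall e, continuous (@on_cell H e)) -> continuous H.
Proof.
move=> cH.
have cc : continuous (curry H : M -> {compact-open, I -> N}).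
  apply/continuous_closedP => A cA; apply: weak_topology_cubes => e.
  exact: (continuous_closedP (curry (@on_cell H e) : _ -> {compact-open, I -> N})).1
    (continuous_curry_fun (cH e)) A cA.
rewrite -[H]curryK; apply: continuous_uncurry cc _.
- exact: unit_interval_locally_compact.
- exact: unit_interval_hausdorff.
move=> x; have [s _ <-] := cube_map_onto x.
apply: (cts_comp (f := fun t => (s, t)) _ (@cH (cell_of x))).
by apply: cts_pair; [exact: cts_cst|exact: cts_id].
Qed.

(** The boundary of a cell meets finitely many smaller cells. Over each of them H
has closed preimages in M * I, as images of compact sets in a Hausdorff space, and
the preimage under the cell e is cut out by the finite union of these. *)
Lemma boundary_continuous (H : M * I -> N) e :
  hausdorff_space M ->
  (forall e', (dim e' < dim e)%N -> continuous (@on_cell H e')) ->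
  cts_on [set w | cube_boundary w.1] (@on_cell H e).
Proof.
move=> hM cH A cA; have [F [finF ltF bF]] := cube_map_boundary e.
have cmap e' : continuous (fun w : cube R (dim e') * I => (cube_map w.1, w.2)).
  apply: cts_pair; last exact: cts_snd.
  exact: cts_comp cts_fst (@cube_map_continuous e').
pose G e' : set (M * I) :=
  (fun w : cube R (dim e') * I => (cube_map w.1, w.2)) @` (@on_cell H e' @^-1` A).
have cG e' : F e' -> closed (G e').
  move=> Fe'; apply: compact_closed.
    exact: hausdorff_pair hM unit_interval_hausdorff.
  apply: continuous_compact; first exact/continuous_subspaceT/cmap.
  have /continuous_closedP cHe := cH _ (ltF _ Fe').
  apply: (subclosed_compact (cHe _ cA) (B := [set: cube R (dim e')] `*` [set: I])).
    exact: compact_setX cube_compact unit_interval_compact.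
  by [].
have -> : [set w | cube_boundary w.1] `&` @on_cell H e @^-1` A =
  [set w | cube_boundary w.1] `&`
  (fun w : cube R (dim e) * I => (cube_map w.1, w.2)) @^-1` (\bigcup_(e' in F) G e').
  apply/seteqP; split=> -[s t] /= [bs h]; split=> //; last first.
    by case: h => e' _ [[s' t'] /= As' [es <-]]; rewrite /on_cell /= -es.
  exists (cell_of (cube_map s)); first exact: bF.
  have [s' _ es'] := cube_map_onto (cube_map s).
  by exists (s', t); rewrite /on_cell /= es'.
apply: closedI.
  have -> : [set w : cube R (dim e) * I | cube_boundary w.1] =
      [set w | rim (@cube_ball R (dim e)) w.1].
    by apply/seteqP; split=> w /= /rim_cube.
  exact: sides_closed.
have /continuous_closedP := @cmap e; apply.
exact: (@closed_bigcup _ {classic C} F G finF cG).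
Qed.

End Homotopies.
End CubicalCells.

Section CellularLifting.
Context {R : realType} {M N B : topologicalType} (cw : cw_structure R M).
Local Notation I := (unit_interval R).
Local Notation dim := (@cell_dim R M cw).
Context (p : M -> B) (q : N -> B) (f g : M -> N).
Variable A : M -> (I -> N) -> Prop.
Hypothesis M_hausdorff : hausdorff_space M.
Hypotheses (f_cts : continuous f) (g_cts : continuous g).
Hypotheses (f_over : forall x, q (f x) = p x) (g_over : forall x, q (g x) = p x).

Hypothesis cell_lift :
  forall (n : nat) (chi : cube R n -> M) (F : cube R n * I -> N),
  continuous chi -> cts_on (rim (product_ball (@cube_ball R n) interval_ball)) F ->
  (forall w, rim (product_ball (@cube_ball R n) interval_ball) w ->
    q (F w) = p (chi w.1)) ->
  (forall s, F (s, zero) = f (chi s)) -> (forall s, F (s, one) = g (chi s)) ->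
  (n = 1 -> forall s, cube_boundary s -> A (chi s) (fun t => F (s, t))) ->
  exists L : cube R n * I -> N, [/\ continuous L, forall w, q (L w) = p (chi w.1),
    forall w, rim (product_ball (@cube_ball R n) interval_ball) w -> L w = F w &
    n = 0 -> forall s, A (chi s) (fun t => L (s, t))].

(** A homotopy over B from f to g on the n-1 skeleton. It is a total map with
arbitrary values outside; the last clause is what makes it extend over edges. *)
Definition lift_below (n : nat) (H : M * I -> N) : Prop :=
  [/\ forall e, (dim e < n)%N -> continuous (@on_cell R M cw N H e),
      forall x t, (dim (cell_of cw x) < n)%N -> q (H (x, t)) = p x,
      forall x, (dim (cell_of cw x) < n)%N -> H (x, zero) = f x /\ H (x, one) = g x &
      forall x, (dim (cell_of cw x) < n)%N -> dim (cell_of cw x) = 0 ->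
        A x (fun t => H (x, t))].

Lemma lift_on_cell (H : M * I -> N) e : lift_below (dim e) H ->
  exists L : cube R (dim e) * I -> N,
  [/\ continuous L, forall w, q (L w) = p (cube_map w.1),
      forall s t, cube_boundary s -> L (s, t) = H (cube_map s, t),
      forall s, L (s, zero) = f (cube_map s) /\ L (s, one) = g (cube_map s) &
      dim e = 0 -> forall s, A (cube_map s) (fun t => L (s, t))].
Proof.
move=> [cH qH H01 AH].
pose F (w : cube R (dim e) * I) := if w.2 == zero then f (cube_map w.1)
  else if w.2 == one then g (cube_map w.1) else H (cube_map w.1, w.2).
have F0 s : F (s, zero) = f (cube_map s) by rewrite /F /= eqxx.
have F1 s : F (s, one) = g (cube_map s).
  by rewrite /F /= eqxx; case: eqP => // /one_neq_zero.
have FH s t : cube_boundary s -> F (s, t) = H (cube_map s, t).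
  move=> /dim_boundary/H01[h0 h1].
  by rewrite /F /=; case: eqP => [->//|_]; case: eqP => [->|].
have rimE (w : cube R (dim e) * I) :
    rim (product_ball (@cube_ball R (dim e)) interval_ball) w <->
    cube_boundary w.1 \/ (w.2 = zero \/ w.2 = one).
  by rewrite rim_prod rim_cube rim_interval.
have cmap (h : M -> N) : continuous h ->
    continuous (fun w : cube R (dim e) * I => h (cube_map w.1)).
  move=> ch; apply: cts_comp ch; apply: cts_comp cts_fst _.
  exact: cube_map_continuous.
have [|w rw|//|//|e1 s bs|L [cL qL LF LA]] := cell_lift (@cube_map_continuous _ _ _ e) (F := F).
- have -> : rim (product_ball (@cube_ball R (dim e)) interval_ball) =
      [set w | cube_boundary w.1] `|` ([set w | w.2 = zero] `|` [set w | w.2 = one]).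
    by apply/seteqP; split=> w /= /rimE.
  apply: cts_on_setU; last apply: cts_on_setU.
  + apply: cts_on_eq (boundary_continuous M_hausdorff cH) => -[s t] /= bs.
    by rewrite FH.
  + apply: (@cts_on_eq _ _ _ (fun w => f (cube_map w.1))).
      by case=> s t /= ->; rewrite F0.
    by apply: cts_on_continuous (cmap _ f_cts); apply: closed_slice; exact: cts_snd.
  + apply: (@cts_on_eq _ _ _ (fun w => g (cube_map w.1))).
      by case=> s t /= ->; rewrite F1.
    by apply: cts_on_continuous (cmap _ g_cts); apply: closed_slice; exact: cts_snd.
- case: w rw => s t /rimE[/= bs|[] /= ->]; rewrite ?F0 ?F1 ?f_over ?g_over//.
  by rewrite FH// qH//; exact: dim_boundary.
- under eq_fun do rewrite FH//.
  have d0 := dim_boundary bs; apply: AH => //.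
  by move: d0; rewrite e1 ltnS leqn0 => /eqP.
exists L; split=> // [s t bs|s].
  by rewrite LF ?FH//; apply/rimE; left.
by rewrite !LF ?F0 ?F1//; apply/rimE; right; [right|left].
Qed.

Lemma lift_step (n : nat) (H : M * I -> N) : lift_below n H ->
  exists2 H' : M * I -> N, lift_below n.+1 H' &
    forall x t, (dim (cell_of cw x) < n)%N -> H' (x, t) = H (x, t).
Proof.
move=> Hn; have [cH qH H01 AH] := Hn.
have ex e : exists L : cube R (dim e) * I -> N, dim e = n ->
  [/\ continuous L, forall w, q (L w) = p (cube_map w.1),
      forall s t, cube_boundary s -> L (s, t) = H (cube_map s, t),
      forall s, L (s, zero) = f (cube_map s) /\ L (s, one) = g (cube_map s) &
      dim e = 0 -> forall s, A (cube_map s) (fun t => L (s, t))].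
  have [en|en] := pselect (dim e = n); last first.
    by exists (fun w => f (cube_map w.1)) => /en.
  have [|L HL] := @lift_on_cell H e; first by rewrite en.
  by exists L.
have [L LP] : {L : forall e, cube R (dim e) * I -> N | forall e, dim e = n ->
  [/\ continuous (L e), forall w, q (L e w) = p (cube_map w.1),
      forall s t, cube_boundary s -> L e (s, t) = H (cube_map s, t),
      forall s, L e (s, zero) = f (cube_map s) /\ L e (s, one) = g (cube_map s) &
      dim e = 0 -> forall s, A (cube_map s) (fun t => L e (s, t))]}.
  by exists (fun e => projT1 (cid (ex e))) => e; exact: (projT2 (cid (ex e))).
pose inner x := projT1 (cid2 (cube_map_onto cw x)).
have innerP x : ~ cube_boundary (inner x) /\ cube_map (inner x) = x.
  by rewrite /inner; case: cid2.
pose H' (w : M * I) := if dim (cell_of cw w.1) == n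
  then L (cell_of cw w.1) (inner w.1, w.2) else H w.
have H'lt x t : (dim (cell_of cw x) < n)%N -> H' (x, t) = H (x, t).
  by move=> ltn; rewrite /H' /= ifF//; rewrite ltn_eqF.
have H'top x t : dim (cell_of cw x) = n ->
    H' (x, t) = L (cell_of cw x) (inner x, t).
  by move=> /eqP xn; rewrite /H' /= ifT.
(* The cell of cube_map s equals e only up to a proof, so cells are compared before
   their dimensions. *)
have Lsame e (s : cube R (dim e)) t e' (s' : cube R (dim e')) : e' = e ->
    ~ cube_boundary s -> ~ cube_boundary s' -> cube_map s' = cube_map s ->
    L e' (s', t) = L e (s, t).
  by move=> ee; subst e' => bs bs' /cube_map_inj ->.
have H'L e (s : cube R (dim e)) t : dim e = n -> H' (cube_map s, t) = L e (s, t).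
  move=> en; have [cL qL LH _ _] := LP e en.
  have [bs|bs] := pselect (cube_boundary s).
    by rewrite LH// H'lt// -en dim_boundary.
  have [bi ei] := innerP (cube_map s).
  rewrite H'top; last by rewrite cell_of_interior.
  by apply: Lsame => //; exact: cell_of_interior.
exists H' => //; split.
- move=> e; rewrite ltnS leq_eqVlt => /orP[/eqP en|en].
    have [cL _ _ _ _] := LP e en.
    have -> : @on_cell R M cw N H' e = L e by apply/funext => -[s t]; exact: H'L.
    exact: cL.
  have -> : @on_cell R M cw N H' e = @on_cell R M cw N H e.
    by apply/funext => -[s t]; apply: H'lt; exact: leq_ltn_trans (dim_cube_map s) en.
  exact: cH.
- move=> x t; rewrite ltnS leq_eqVlt => /orP[/eqP xn|xn]; last by rewrite H'lt ?qH.
  by have [_ qL _ _ _] := LP _ xn; rewrite H'top// qL /= (innerP x).2.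
- move=> x; rewrite ltnS leq_eqVlt => /orP[/eqP xn|xn]; last by rewrite !H'lt//; exact: H01.
  have [_ _ _ L01 _] := LP _ xn; rewrite !H'top//.
  by have := L01 (inner x); rewrite (innerP x).2.
- move=> x; rewrite ltnS leq_eqVlt => /orP[/eqP xn|xn] x0; last first.
    by under eq_fun do rewrite H'lt//; exact: AH.
  have [_ _ _ _ LA] := LP _ xn; under eq_fun do rewrite H'top//.
  by have := LA x0 (inner x); rewrite (innerP x).2.
Qed.

(** The homotopies on the skeleta extend one another, so their union is defined
pointwise: the value at x is taken from the stage just after the cell of x is
treated. *)
Theorem cellular_homotopy : homotopic_over R p q f g.
Proof.
have start : lift_below 0 (fun w => f w.1) by split.
pose next n (Hn : {H : M * I -> N | lift_below n H}) :=
  cid2 (lift_step (svalP Hn)).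
pose tower : forall n, {H : M * I -> N | lift_below n H} :=
  nat_rect (fun n => {H : M * I -> N | lift_below n H})
    (exist _ (fun w => f w.1) start)
    (fun n Hn => exist _ (s2val (next n Hn)) (s2valP (next n Hn))).
have towerS n x t : (dim (cell_of cw x) < n)%N ->
    sval (tower n.+1) (x, t) = sval (tower n) (x, t).
  exact: (s2valP' (next n (tower n)) x t).
pose H (w : M * I) := sval (tower (dim (cell_of cw w.1)).+1) w.
have HE n x t : (dim (cell_of cw x) < n)%N -> H (x, t) = sval (tower n) (x, t).
  elim: n => // n IHn; rewrite ltnS leq_eqVlt => /orP[/eqP <-//|xn].
  by rewrite towerS// IHn.
exists H; split=> [|x|x|x t].
- apply: (homotopy_continuous (cw := cw)) => e.
  have [cH _ _ _] := svalP (tower (dim e).+1).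
  have -> : @on_cell R M cw N H e = @on_cell R M cw N (sval (tower (dim e).+1)) e.
    by apply/funext => -[s t]; apply: HE; rewrite ltnS dim_cube_map.
  by apply: cH; rewrite ltnS.
- by have [_ _ H01 _] := svalP (tower (dim (cell_of cw x)).+1); exact: (H01 x (ltnSn _)).1.
- by have [_ _ H01 _] := svalP (tower (dim (cell_of cw x)).+1); exact: (H01 x (ltnSn _)).2.
- by have [_ qH _ _] := svalP (tower (dim (cell_of cw x)).+1); exact: (qH x t (ltnSn _)).
Qed.

End CellularLifting.
(** * Conjugate loops and squares *)

Section ConjugateLoops.
Context {R : realType} {X : topologicalType} {x y : X}.
Local Notation I := (unit_interval R).
Context (phi : {path I from x to x in X}) (psi : {path I from y to y in X}).

(** The case of a family of left sides that starts at a constant path: a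
homotopy relative to the endpoints becomes a square. *)
Lemma square_conj_const (V : I * I -> X) (om : {path I from x to x in X})
    (gam : {path I from x to y in X}) :
  continuous V -> (forall s, V (s, zero) = om s) -> (forall s, V (s, one) = gam s) ->
  (forall t, V (zero, t) = x) ->
  path_homotopic (path_cat (path_cat om phi) (path_inv om))
    (path_cat (path_cat gam psi) (path_inv gam)) <->
  square (fun t => V (one, t)) phi psi (fun t => V (one, t)).
Proof.
move=> cV V0 V1 Vx.
have D := square_conj phi psi cV cV V0 V1 V0 V1.
have e : (fun t => V (zero, t)) = (fun=> x) by apply/funext.
by rewrite -D e; exact: path_homotopic_square.
Qed.

(** The family V runs through the middle portions of the concatenation c: at time
s the portion of length s about the point 1/2, where om and gam meet. *)
Lemma square_of_conj (om : {path I from x to x in X}) (gam : {path I from x to y in X}) :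
  path_homotopic (path_cat (path_cat om phi) (path_inv om))
    (path_cat (path_cat gam psi) (path_inv gam)) ->
  square (path_cat (path_inv om) gam) phi psi (path_cat (path_inv om) gam).
Proof.
set c := path_cat (path_inv om) gam.
pose V (w : I * I) := c (clamp (2^-1 + ival w.1 * (ival w.2 - 2^-1))).
have cV : continuous V.
  apply: cts_comp (@cts_fun _ _ c); apply/cts_clamp/cts_addr; first exact: cts_cst.
  apply: cts_mulr; first exact: cts_ival cts_fst.
  by apply: cts_addr; [exact: cts_ival cts_snd|exact: cts_cst].
have V0 s : V (s, zero) = om s.
  have s0 := ival_ge0 s; have s1 := ival_le1 s.
  have E : ival (clamp (2^-1 + ival s * (0 - 2^-1))) = 2^-1 * (1 - ival s).
    by rewrite clampE; lra.
  rewrite /V /= ival0 /c path_catE E ifT; last by lra.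
  rewrite path_invE -[in RHS](ivalK s); congr (om (clamp _)).
  by rewrite clampE; lra.
have V1 s : V (s, one) = gam s.
  have s0 := ival_ge0 s; have s1 := ival_le1 s.
  have E : ival (clamp (2^-1 + ival s * (1 - 2^-1))) = 2^-1 * (1 + ival s).
    by rewrite clampE; lra.
  rewrite /V /= ival1 /c path_catE E; case: ifP => [h|_]; last first.
    by rewrite -[in RHS](ivalK s); congr (gam (clamp _)); lra.
  have -> : s = zero by apply/zeroP; lra.
  by rewrite ival0 addr0 mulr1 mulr2V -ioneE !(path_one, path_zero).
have Vx t : V (zero, t) = x.
  have E : ival (clamp (2^-1 + 0 * (ival t - 2^-1)) : I) = 2^-1 by rewrite clampE; lra.
  by rewrite /V /= ival0 /c path_catE E lexx mulr2V -ioneE path_one.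
move/(square_conj_const cV V0 V1 Vx).
have -> // : (fun t => V (one, t)) = c.
by apply/funext => t; rewrite /V /= ival1 mul1r addrC subrK ivalK.
Qed.

(** The family V at time s runs backwards from c s to c (s/2). The point c s
traces c, the point c (s/2) traces gam, and at s = 1 the portion run through is
the second half of c reversed, which is del. *)
Lemma conj_of_square (del gam : {path I from x to y in X}) :
  square del phi psi del ->
  path_homotopic
    (path_cat (path_cat (path_cat gam (path_inv del)) phi)
       (path_inv (path_cat gam (path_inv del))))
    (path_cat (path_cat gam psi) (path_inv gam)).
Proof.
set c := path_cat gam (path_inv del).
pose V (w : I * I) := c (clamp (ival w.1 * (1 - 2^-1 * ival w.2))).
have cV : continuous V.
  apply: cts_comp (@cts_fun _ _ c); apply/cts_clamp/cts_mulr.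
    exact: cts_ival cts_fst.
  apply: cts_addr; first exact: cts_cst.
  by apply/cts_oppr/cts_mulr; [exact: cts_cst|exact: cts_ival cts_snd].
have V0 s : V (s, zero) = c s by rewrite /V /= ival0 mulr0 subr0 mulr1 ivalK.
have V1 s : V (s, one) = gam s.
  have s0 := ival_ge0 s; have s1 := ival_le1 s.
  have E : ival (clamp (ival s * (1 - 2^-1 * 1))) = 2^-1 * ival s.
    by rewrite clampE; lra.
  rewrite /V /= ival1 /c path_catE E ifT; last by lra.
  by rewrite -[in RHS](ivalK s); congr (gam (clamp _)); lra.
have Vx t : V (zero, t) = x by rewrite /V /= ival0 mul0r -izeroE path_zero.
have Vd : (fun t => V (one, t)) = del.
  apply/funext => t; have t0 := ival_ge0 t; have t1 := ival_le1 t.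
  have E : ival (clamp (1 * (1 - 2^-1 * ival t))) = 1 - 2^-1 * ival t.
    by rewrite clampE; lra.
  rewrite /V /= ival1 /c path_catE E; case: ifP => [h|_].
    have -> : t = one by apply/oneP; lra.
    rewrite ival1 (_ : 2 * _ = 1) -?ioneE ?path_one//; lra.
  rewrite path_invE -[in RHS](ivalK t); congr (del (clamp _)).
  by rewrite clampE; lra.
by move=> sq; apply/(square_conj_const cV V0 V1 Vx); rewrite Vd.
Qed.

Lemma conj_loop_class (om : {path I from x to x in X}) (gam : {path I from x to y in X}) :
  pi1_change gam (loop_class psi) =
    (loop_class om * loop_class phi * (loop_class om)^-1)%g <->
  path_homotopic (path_cat (path_cat om phi) (path_inv om))
    (path_cat (path_cat gam psi) (path_inv gam)).
Proof.
have -> : (loop_class om * loop_class phi * (loop_class om)^-1)%g =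
    loop_class (path_cat (path_cat om phi) (path_inv om)).
  by rewrite -pi1_mulE -pi1_mulE -pi1_invE.
rewrite pi1_changeE; split=> [/esym/loop_classP//|h].
by apply/esym/loop_classP.
Qed.

End ConjugateLoops.

Theorem theorem8 (R : realType) (M N B : topologicalType)
  (p : continuousType M B) (q : continuousType N B)
  (p_fib : hurewicz_fibration R p) (q_fib : hurewicz_fibration R q)
  (f g : continuousType M N) (f_over : q \o f =1 p) (g_over : q \o g =1 p)
  (m1 : M)
  (M_pc : path_connected R M) (M_cw : is_CW_complex R M)
  (N_pc : path_connected R N) (N_cw : is_CW_complex R N)
  (B_pc : path_connected R B) (B_cw : is_CW_complex R B)
  (SM_pc : path_connected R (fiber p (p m1)))
  (SM_cw : is_CW_complex R (fiber p (p m1)))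
  (SN_pc : path_connected R (fiber q (p m1)))
  (SN_cw : is_CW_complex R (fiber q (p m1)))
  (SM_K : is_K_pi_1 R (fiber p (p m1)))
  (SN_K : is_K_pi_1 R (fiber q (p m1)))
  (B_K : is_K_pi_1 R B)
  (gamma : {path (unit_interval R) from fiber_pt f_over m1 to fiber_pt g_over m1
            in fiber q (p m1)}) :
  homotopic_over R p q f g <->
  sim_fiber R (fiber_pt f_over m1)
    (pi1_map f : pi1 R m1 -> pi1 R (f m1))
    ((pi1_change (fiber_path gamma) : pi1 R (g m1) -> pi1 R (f m1))
     \o (pi1_map g : pi1 R m1 -> pi1 R (g m1))).
Proof.
pose I := unit_interval R.
pose S := fiber q (p m1).
have qS (z : S) : q (fiber_incl z) = p m1 by exact: set_valP z.
pose gam : {path I from f m1 to g m1 in N} := fiber_path gamma.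
split=> [[H [cH H0 H1 Hq]]|[w [u0 _ <-] wE]].
- have dP t : H (m1, t) \in q @^-1` [set p m1] by rewrite inE /= Hq.
  pose d (t : I) : S := exist (fun y => y \in q @^-1` [set p m1]) _ (dP t).
  have cd : continuous d.
    apply: continuous_comp_initial.
    have -> : set_val \o d = (fun t => H (m1, t)) by [].
    by apply: cts_comp cH; apply: cts_pair; [exact: cts_cst|exact: cts_id].
  have d0 : d zero = fiber_pt f_over m1 by apply: val_inj; rewrite /= H0.
  have d1 : d one = fiber_pt g_over m1 by apply: val_inj; rewrite /= H1.
  pose om := path_cat gamma (path_inv (mk_path cd d0 d1)).
  exists (pi1_map (@fiber_incl N B q (p m1)) (loop_class om)).
    by exists (loop_class om).
  move=> u; rewrite /= -[u]loop_reprK; set l := loop_repr u.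
  pose del : {path I from f m1 to g m1 in N} := fiber_path (mk_path cd d0 d1).
  pose fl : {path I from f m1 to f m1 in N} := f \o l.
  pose gl : {path I from g m1 to g m1 in N} := g \o l.
  have sq : square del fl gl del.
    exists (fun st => H (l st.1, st.2)); split=> [|t|t|s|s] /=.
    + apply: cts_comp cH; apply: cts_pair; last exact: cts_snd.
      by apply: cts_comp cts_fst _; exact: cts_fun.
    + by rewrite path_zero.
    + by rewrite path_one.
    + exact: H0.
    + exact: H1.
  have /conj_loop_class h := conj_of_square gam sq.
  have omE : path_cat gam (path_inv del) =
      (fiber_path om : {path I from f m1 to f m1 in N}).
    by apply/path_eqP => t; rewrite /= !path_catE; case: ifP.
  rewrite omE in h; rewrite !pi1_mapE; exact: h.
- pose om : {path I from f m1 to f m1 in N} := fiber_path (loop_repr u0).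
  pose delta := path_cat (path_inv om) gam.
  have loops (l : {path I from m1 to m1 in M}) : square delta (f \o l) (g \o l) delta.
    apply: (@square_of_conj R N (f m1) (g m1) (f \o l) (g \o l)).
    apply/conj_loop_class; have := wE (loop_class l).
    rewrite /= !pi1_mapE -[u0 in pi1_map _ u0]loop_reprK pi1_mapE; exact.
  have delta_over t : q (delta t) = p m1.
    by rewrite path_catE; case: ifP => _; exact: qS.
  have [M_hausdorff [cw]] := M_cw.
  apply: (@cellular_homotopy R M N B cw p q f g (@admissible R M N f g m1 delta)) => //.
  + exact: cts_fun.
  + exact: cts_fun.
  + exact: (@cell_lift R M N B p q f g m1 delta loops q_fib f_over g_over delta_over
      M_pc B_K SN_K).
Qed.
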